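(* Let $(\mathcal G,\mathcal S)$ be a twisted Boolean inverse semigroup and let $(G,\Sigma)$ be its twisted groupoid of germs; identify $\mathcal S$ with the inverse semigroup of compact continuous bisections of $\Sigma$ via $s\mapsto S(s)$. Then there is a one-to-one correspondence between the representations $\pi$ of $(\mathcal G,\mathcal S)$ and the representations $\tilde\pi$ of the $*$-algebra $C_c(G,\Sigma)$ such that $\pi(S)=\tilde\pi(\Delta_S)$ for all $S\in\mathcal S$.
   Context: $\mathbb T$ is the group of complex numbers of modulus one. Representations are in Hilbert spaces; representations of $C_c(G,\Sigma)$ are $*$-representations by bounded operators. Inverse semigroup: each $s$ has a unique $s^*$ with $ss^*s=s$, $s^*ss^*=s^*$; $\mathcal G^{(0)}$ is the set of idempotents, $d(s)=s^*s$, $r(s)=ss^*$, $s\le t$ iff $s=te$ for some idempotent $e$. A pair $(s,t)$ is orthogonal if $s^*t=st^*=0$. $\mathcal G$ (with zero) is Boolean if $\mathcal G^{(0)}$ is a Boolean algebra (possibly without unit) and every orthogonal pair has a join $s\vee t$. Let $X$ be the dual Boolean space (locally compact Hausdorff totally disconnected) of $\mathcal G^{(0)}$, so $\mathcal G^{(0)}=\mathcal B(X)$, the compact open subsets of $X$. $\mathcal T(X)$ is the inverse semigroup (under multiplication) of continuous functions $h:\mathrm{supp}(h)\to\mathbb T$ with $\mathrm{supp}(h)\subset X$ compact open. Twisted Boolean inverse semigroup $(\mathcal G,\mathcal S)$: an inverse semigroup extension $\mathcal T\rightarrowtail\mathcal S\xrightarrow{p}\mathcal G$ ($p$ a surjective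 homomorphism, identifying the idempotents of $\mathcal S$ with $\mathcal G^{(0)}$, with $p^{-1}(\mathcal G^{(0)})=\mathcal T$), where $\mathcal G$ is Boolean, $\mathcal T=\mathcal T(X)$, and $shs^*=h\circ\varphi_s^{-1}$ for $s\in\mathcal S,h\in\mathcal T$; here $\varphi_s:\mathrm{dom}(s)\to\mathrm{ran}(s)$ is the homeomorphism between the compact open subsets of $X$ given by $d(s),r(s)$, dual to $e\mapsto ses^*$. Twisted groupoid of germs: on pairs $(s,x)$, $s\in\mathcal S$, $x\in\mathrm{dom}(s)$, let $(s,x)\sim(t,y)$ iff $x=y$ and $sa=tb$ for some $a,b\in\mathcal T(X)$ with $a(x)=b(x)=1$; $(s,x)\approx(t,y)$ iff $x=y$ and $sa=tb$ for some $a,b\in\mathcal T(X)$ with $|a(x)|=|b(x)|=1$. Classes $[s,x]$ form $\Sigma$, classes $[[s,x]]$ form $G$; both are groupoids with unit space $X$, with $[s,\varphi_t(x)][t,x]=[st,x]$, $[s,x]^{-1}=[s^*,\varphi_s(x)]$, and similarly for $[[\cdot]]$. Basic open sets of $G$: $\{[[s,x]]:x\in\mathrm{dom}(s)\cap U\}$, $U\subset X$ open; of $\Sigma$: $S(s)W$ with $S(s)=\{[s,x]:x\in\mathrm{dom}(s)\}$, $W\subset\mathbb T$ open, where $[s,x]\theta=[sc,x]$ for $c\in\mathcal T(X)$ with $c(x)=\theta$. The map $s\mapsto S(s)$ is an isomorphism of $\mathcal S$ onto the inverse semigroup of compact continuous bisections of $\Sigma$ (compact subsets on which range and domain maps are homeomorphisms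 onto open subsets of $X$). $\Delta_S(\sigma)=\overline\theta$ if $\sigma=\theta\tau$ with $\theta\in\mathbb T,\tau\in S$, and $0$ if $\sigma\notin\mathbb TS$. $C_c(G,\Sigma)$ is the $*$-algebra of finite sums of functions $\sigma\mapsto\Delta_S(\sigma)b(d(\sigma))$, $S\in\mathcal S$, $b\in C_c(X)$, with $f*g(\sigma)=\sum_{\tau'\in r^{-1}(r(\sigma))}f(\tau)g(\tau^{-1}\sigma)$ ($\tau\in\Sigma$ any lift of $\tau'\in G$) and $f^*(\sigma)=\overline{f(\sigma^{-1})}$. Representation of $(\mathcal G,\mathcal S)$ in a Hilbert space $K$: a map $\pi:\mathcal S\to B(K)$ with (i) $\pi(st)=\pi(s)\pi(t)$; (ii) $\pi(s^* )=\pi(s)^*$; (iii) $\pi(s\vee t)=\pi(s)+\pi(t)$ for every orthogonal pair $(s,t)$ in $\mathcal S$; (iv) $\pi(0)=0$; (v) $\pi(h)=\tilde\pi^{(0)}(h)$ for $h\in\mathcal T(X)$, where $\tilde\pi^{(0)}$ is the extension to $C_0(X)$ of the restriction of $\pi$ to $\mathcal B(X)$ and $h$ is extended by $0$ outside its support. *)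

(* Defs.v *)
From HB Require Import structures.
From mathcomp Require Import all_boot all_order all_algebra.
From mathcomp Require Import all_classical all_reals all_analysis.
From mathcomp Require Import complex generic_quotient.

Set Implicit Arguments.
Unset Strict Implicit.
Unset Printing Implicit Defensive.

Import Order.TTheory GRing.Theory Num.Theory.
Import numFieldNormedType.Exports.

Local Open Scope classical_set_scope.
Local Open Scope ring_scope.
Local Open Scope quotient_scope.

(* [complex R] itself carries no topology; as a [numClosedFieldType] it gets
   the one of its norm. *)
Definition Cplx (R : realType) : numClosedFieldType := R[i]%C.

HB.mixin Record isHilbert (R : realType) K
    of CompleteNormedModule (Cplx R) K := {
  hdot : {dot K for @Num.conj (Cplx R)} ;
  hdot_norm : forall u : K, `|u| ^+ 2 = hdot u u
}.

#[short(type="hilbertType")]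
HB.structure Definition Hilbert (R : realType) :=
  {K of isHilbert R K & CompleteNormedModule (Cplx R) K}.

Record boundedOp (R : realType) (K : hilbertType R) := BoundedOp {
  bop_fun :> K -> K ;
  bop_linear : linear bop_fun ;
  bop_bounded : exists M : Cplx R, forall u : K, `|bop_fun u| <= M * `|u|
}.

(* [A] is meant to be a *-algebra of functions on [Y], with the pointwise linear
   structure, the product [m] and the involution [st]: its closure under the
   operations is not part of the data, so each condition quantifies over an
   element [h] of [A] equal to the result of the operation. *)
Record star_rep (R : realType) (Y : Type) (A : set (Y -> Cplx R))
    (m : (Y -> Cplx R) -> (Y -> Cplx R) -> Y -> Cplx R)
    (st : (Y -> Cplx R) -> Y -> Cplx R)
    (K : hilbertType R) (rho : A -> boundedOp K) : Prop := StarRep {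
  star_repD : forall f g h : A,
    (forall y, val h y = val f y + val g y) ->
    forall u, rho h u = rho f u + rho g u ;
  star_repZ : forall (c : Cplx R) (f h : A),
    (forall y, val h y = c * val f y) ->
    forall u, rho h u = c *: rho f u ;
  star_repM : forall f g h : A,
    val h = m (val f) (val g) -> forall u, rho h u = rho f (rho g u) ;
  star_repJ : forall f h : A,
    val h = st (val f) -> forall u v, hdot (rho h u) v = hdot u (rho f v)
}.

HB.mixin Record isInverseSemigroup0 S of Semigroup S := {
  istar : S -> S ;
  izero : S ;
  mulKs : forall s : S, (s * istar s * s = s)%g ;
  mulsK : forall s : S, (istar s * s * istar s = istar s)%g ;
  istar_unique : forall s t : S,
    (s * t * s = s)%g -> (t * s * t = t)%g -> t = istar s ;
  mul0s : forall s : S, (izero * s = izero)%g ;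
  muls0 : forall s : S, (s * izero = izero)%g
}.

#[short(type="invSemigroupType")]
HB.structure Definition InvSemigroup :=
  {S of isInverseSemigroup0 S & Semigroup S}.

Notation "s ^*" := (istar s) : group_scope.

Section InverseSemigroups.
Context {S : invSemigroupType}.
Implicit Types s t e f g j : S.

Definition idem e := (e * e = e)%g.

Definition ile s t := exists2 e, idem e & s = (t * e)%g.

Definition is_join s t j :=
  [/\ ile s j, ile t j & forall k, ile s k -> ile t k -> ile j k].

Definition orthogonal_pair s t := (s^* * t = izero)%g /\ (s * t^* = izero)%g.

Definition is_idem_join e f j :=
  [/\ idem j, ile e j, ile f j &
      forall k, idem k -> ile e k -> ile f k -> ile j k].

End InverseSemigroups.

(* The idempotents form a Boolean algebra, possibly without unit (their meet
   is the product), and orthogonal pairs have joins. *)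
Record boolean (G : invSemigroupType) : Prop := Boolean {
  boolean_idem_join : forall e f : G, idem e -> idem f ->
    exists j, is_idem_join e f j ;
  boolean_idem_distr : forall e f g j : G, idem e -> idem f -> idem g ->
    is_idem_join f g j -> is_idem_join (e * f)%g (e * g)%g (e * j)%g ;
  boolean_idem_compl : forall e f : G, idem e -> idem f -> ile e f ->
    exists g, [/\ idem g, (e * g)%g = izero & is_idem_join e g f] ;
  boolean_join : forall s t : G, orthogonal_pair s t -> exists j, is_join s t j
}.

HB.mixin Record isBooleanSpace X of Topological X := {
  boolean_hausdorff : hausdorff_space X ;
  boolean_locally_compact : locally_compact [set: X] ;
  boolean_totally_disconnected : totally_disconnected [set: X]
}.

#[short(type="booleanSpaceType")]
HB.structure Definition BooleanSpace :=
  {X of isBooleanSpace X & Topological X}.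

(* [dual_supp] identifies the idempotents of [G] with the compact open subsets
   of [X], as ordered sets; it is only meaningful on idempotents. *)
Record dualSpace (X : booleanSpaceType) (G : invSemigroupType) := DualSpace {
  dual_supp : G -> set X ;
  dual_compact : forall e, idem e -> compact (dual_supp e) ;
  dual_open : forall e, idem e -> open (dual_supp e) ;
  dual_le : forall e f, idem e -> idem f ->
    (ile e f <-> dual_supp e `<=` dual_supp f) ;
  dual_surj : forall U : set X, compact U -> open U ->
    exists2 e, idem e & dual_supp e = U
}.

(* The elements of T(X) are extended by 0 outside their support.  The support
   is open because the extension is continuous; conversely, as compact open
   sets are clopen, the extension by 0 of a continuous function on a compact
   open set is continuous. *)
Record circleFun (R : realType) (X : booleanSpaceType) := CircleFun {
  circle_fun :> X -> Cplx R ;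
  circle_continuous : continuous circle_fun ;
  circle_compact : compact [set x | circle_fun x != 0] ;
  circle_norm1 : forall x, circle_fun x != 0 -> `|circle_fun x| = 1
}.

Definition circle_supp (R : realType) (X : booleanSpaceType)
  (h : circleFun R X) : set X := [set x | h x != 0].

HB.instance Definition _ (R : realType) (X : booleanSpaceType) :=
  gen_eqMixin (circleFun R X).
HB.instance Definition _ (R : realType) (X : booleanSpaceType) :=
  gen_choiceMixin (circleFun R X).

Section CircleFunctions.
Context {R : realType} {X : booleanSpaceType}.
Implicit Types h k : circleFun R X.

Lemma circleP h k : (forall x, h x = k x) -> h = k.
Proof.
case: h k => [h hc hs h1] [k kc ks k1] /= hk.
have {}hk : h = k by apply/funext.
by subst k; congr CircleFun; exact: Prop_irrelevance.
Qed.

Lemma circle_normsq h x : h x * (h x)^* * h x = h x.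
Proof.
have [->|h0] := eqVneq (h x) 0; first by rewrite mulr0.
by rewrite -normCK (circle_norm1 h0) expr1n mul1r.
Qed.

Lemma circle_mul_continuous h k : continuous (fun x => h x * k x).
Proof. by move=> x; apply: cvgM; exact: circle_continuous. Qed.

Lemma circle_mul_compact h k : compact [set x | h x * k x != 0].
Proof.
have -> : [set x | h x * k x != 0] = circle_supp h `&` circle_supp k.
  by apply/seteqP; split=> x /=; rewrite mulf_eq0 negb_or => /andP.
apply: compact_closedI; first exact: circle_compact.
by apply: compact_closed; [exact: boolean_hausdorff|exact: circle_compact].
Qed.

Lemma circle_mul_norm1 h k x : h x * k x != 0 -> `|h x * k x| = 1.
Proof.
rewrite mulf_eq0 negb_or => /andP[h0 k0].
by rewrite normrM !circle_norm1 // mulr1.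
Qed.

Definition circle_mul h k := CircleFun
  (@circle_mul_continuous h k) (@circle_mul_compact h k) (@circle_mul_norm1 h k).

Lemma circle_conj_continuous h : continuous (fun x => (h x)^*).
Proof.
move=> x; apply/cvgrPdist_lt => e e0.
have /cvgrPdist_lt/(_ e e0) := @circle_continuous _ _ h x.
by apply: filterS => y; rewrite -rmorphB norm_conjC.
Qed.

Lemma circle_conj_compact h : compact [set x | (h x)^* != 0].
Proof.
have -> : [set x | (h x)^* != 0] = circle_supp h.
  by apply/seteqP; split=> x /=; rewrite conjC_eq0.
exact: circle_compact.
Qed.

Lemma circle_conj_norm1 h x : (h x)^* != 0 -> `|(h x)^*| = 1.
Proof. by rewrite conjC_eq0 norm_conjC; exact: circle_norm1. Qed.

Definition circle_conj h := CircleFun (@circle_conj_continuous h)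
  (@circle_conj_compact h) (@circle_conj_norm1 h).

Lemma indicator_continuous (U : set X) :
  compact U -> open U -> continuous (fun x => (x \in U)%:R : Cplx R).
Proof.
move=> cU oU x.
have clU : closed U by apply: compact_closed => //; exact: boolean_hausdorff.
rewrite /continuous_at; have [xU|xU] := pselect (U x).
  rewrite (mem_set xU).
  apply: cvg_near_cst; move: (open_nbhs_nbhs (conj oU xU)).
  by apply: filterS => y Uy; rewrite mem_set.
rewrite (memNset xU).
apply: cvg_near_cst.
have oCU : open (~` U) by rewrite openC.
move: (open_nbhs_nbhs (conj oCU xU)).
by apply: filterS => y Uy; rewrite memNset.
Qed.

Lemma indicator_supp (U : set X) :
  [set x | (x \in U)%:R != 0 :> Cplx R] = U.
Proof. by apply/seteqP; split=> x /=; rewrite pnatr_eq0 eqb0 negbK inE. Qed.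

Lemma indicator_norm1 (U : set X) x :
  (x \in U)%:R != 0 :> Cplx R -> `|(x \in U)%:R : Cplx R| = 1.
Proof. by case: (x \in U); rewrite ?eqxx // normr1. Qed.

Definition circle_indicator (U : set X) (cU : compact U) (oU : open U) :=
  CircleFun (indicator_continuous cU oU)
    (eq_ind_r compact cU (indicator_supp U)) (@indicator_norm1 U).

Definition circle_zero := circle_indicator (@compact0 X) (@open0 X).

Lemma circle_zeroE x : circle_zero x = 0.
Proof. by rewrite /= memNset. Qed.

Lemma circle_mulA : associative circle_mul.
Proof. by move=> f g h; apply: circleP => x /=; rewrite mulrA. Qed.

HB.instance Definition _ := isSemigroup.Build (circleFun R X) circle_mulA.

Lemma circle_mulE h k x : (h * k)%g x = h x * k x. Proof. by []. Qed.

Lemma circle_mulKs h : (h * circle_conj h * h)%g = h.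
Proof. by apply: circleP => x; rewrite !circle_mulE circle_normsq. Qed.

Lemma circle_mulsK h : (circle_conj h * h * circle_conj h)%g = circle_conj h.
Proof.
apply: circleP => x; rewrite !circle_mulE /=.
by rewrite -[RHS](congr1 Num.conj (circle_normsq h x)) !rmorphM /= conjCK.
Qed.

Lemma circle_conj_unique h k :
  (h * k * h)%g = h -> (k * h * k)%g = k -> k = circle_conj h.
Proof.
move=> hkh khk; apply: circleP => x /=.
have := congr1 (fun f : circleFun R X => f x) hkh.
have := congr1 (fun f : circleFun R X => f x) khk.
rewrite !circle_mulE; have [->|h0] := eqVneq (h x) 0.
  by rewrite mulr0 mul0r conjC0.
move=> _ /(canRL (mulfK h0)); rewrite divff // => hk.
have hh : h x * (h x)^* = 1 by rewrite -normCK circle_norm1 // expr1n.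
by apply: (mulfI h0); rewrite hk hh.
Qed.

Lemma circle_mul0s h : (circle_zero * h)%g = circle_zero.
Proof. by apply: circleP => x; rewrite circle_mulE circle_zeroE mul0r. Qed.

Lemma circle_muls0 h : (h * circle_zero)%g = circle_zero.
Proof. by apply: circleP => x; rewrite circle_mulE circle_zeroE mulr0. Qed.

HB.instance Definition _ := isInverseSemigroup0.Build (circleFun R X)
  circle_mulKs circle_mulsK circle_conj_unique circle_mul0s circle_muls0.

Lemma circle_mulC h k : (h * k)%g = (k * h)%g.
Proof. by apply: circleP => x; rewrite !circle_mulE mulrC. Qed.

End CircleFunctions.

Section DualHomeomorphism.
Context {X : booleanSpaceType} {G S : invSemigroupType}.
Variables (D : dualSpace X G) (p : S -> G).
Implicit Types (s e : S) (x y : X).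

Definition bis_dom s : set X := dual_supp D (p (s^* * s)%g).
Definition bis_ran s : set X := dual_supp D (p (s * s^*)%g).

(* The homeomorphism dual to [e |-> s e s^*], i.e., such that the image of the
   compact open set of [e <= d(s)] is that of [s e s^*].  For [x] in [bis_dom s],
   exactly one [y] satisfies the condition. *)
Definition dual_map s x : X := xget x
  [set y | forall e, idem e -> ile e (s^* * s)%g ->
    (dual_supp D (p e) x <-> dual_supp D (p (s * e * s^*)%g) y)].

End DualHomeomorphism.

Record twist (R : realType) (X : booleanSpaceType) (G S : invSemigroupType)
    (D : dualSpace X G) := Twist {
  tw_p : {multiplicative S -> G} ;
  tw_i : {multiplicative circleFun R X -> S} ;
  tw_p_surj : forall g, exists s, tw_p s = g ;
  tw_p_idem : set_bij [set e | idem e] [set e | idem e] tw_p ;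
  tw_i_inj : injective tw_i ;
  tw_exact : forall s, idem (tw_p s) <-> exists h, tw_i h = s ;
  (* The identifications of the idempotents of [G] with the compact open
     subsets of [X] through [D] and through T(X) agree. *)
  tw_idem_supp : forall h, idem h -> dual_supp D (tw_p (tw_i h)) = circle_supp h ;
  (* s h s^* is the function [h \o dual_map s ^-1] on [bis_ran s] *)
  tw_conj : forall s h, exists k, [/\ (s * tw_i h * s^*)%g = tw_i k,
    circle_supp k `<=` bis_ran D tw_p s &
    forall x, bis_dom D tw_p s x -> k (dual_map D tw_p s x) = h x]
}.

Section Germs.
Context {R : realType} {X : booleanSpaceType} {G S : invSemigroupType}
  {D : dualSpace X G}.
Variable tw : twist R S D.

Local Notation T := (circleFun R X).
Local Notation C := (Cplx R).
Local Notation p := (tw_p tw).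
Local Notation i := (tw_i tw).
Local Notation dom := (bis_dom D p).
Local Notation phi := (dual_map D p).

Lemma circle1_at s x : dom s x -> exists a : T, a x = 1.
Proof.
move=> sx.
have ds : idem (p (s^* * s)%g).
  by rewrite /idem -gmulfM mulgA mulsK.
exists (circle_indicator (dual_compact ds) (dual_open D ds)).
by rewrite /= mem_set.
Qed.

Definition germ_pair := {u : S * X | `[< dom u.1 u.2 >]}.

Lemma germ_pairP (u : germ_pair) : dom (val u).1 (val u).2.
Proof. exact/asboolP/(valP u). Qed.

Section GermRelation.
Context (P : C -> Prop) (P1 : P 1).
Context (PM : forall z w, P z -> P w -> P (z * w)).

Definition germ_rel_at (u v : germ_pair) : bool := `[<
  (val u).2 = (val v).2 /\
  exists a b : T, [/\ P (a (val u).2), P (b (val u).2) &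
    ((val u).1 * i a = (val v).1 * i b)%g] >].

Lemma germ_rel_refl : reflexive germ_rel_at.
Proof.
move=> u; apply/asboolP; split=> //.
have [a ax] := circle1_at (germ_pairP u).
by exists a, a; rewrite ax.
Qed.

Lemma germ_rel_sym : symmetric germ_rel_at.
Proof.
suff H u v : germ_rel_at u v -> germ_rel_at v u by move=> u v; apply/idP/idP; exact: H.
move=> /asboolP[uv [a [b [pa pb e]]]]; apply/asboolP; split=> //.
by exists b, a; rewrite -uv -e.
Qed.

Lemma germ_rel_trans : transitive germ_rel_at.
Proof.
move=> v u w /asboolP[uv [a [b [pa pb e]]]] /asboolP[vw [c [d [pc pd f]]]].
apply/asboolP; split; first by rewrite uv.
exists (a * c)%g, (d * b)%g; rewrite !circle_mulE; split.
- by apply: PM => //; rewrite uv.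
- by apply: PM => //; rewrite uv.
- by rewrite !gmulfM !mulgA e -f -!mulgA -!gmulfM circle_mulC.
Qed.

End GermRelation.

Definition germ_sim := germ_rel_at (fun z => z = 1).
(* Here |a(x)| = 1 means that x is in the support of a. *)
Definition germ_approx := germ_rel_at (fun z => `|z| = 1).

Lemma germ_sim_trans : transitive germ_sim.
Proof. by apply: germ_rel_trans => z w -> ->; rewrite mulr1. Qed.

Lemma germ_approx_trans : transitive germ_approx.
Proof. by apply: germ_rel_trans => z w z1 w1; rewrite normrM z1 w1 mulr1. Qed.

Canonical germ_sim_equiv := EquivRel germ_sim
  (@germ_rel_refl (fun z => z = 1) erefl) (@germ_rel_sym _) germ_sim_trans.
Canonical germ_approx_equiv := EquivRel germ_approx
  (@germ_rel_refl (fun z => `|z| = 1) (normr1 _)) (@germ_rel_sym _) germ_approx_trans.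

Definition Sigma := {eq_quot germ_sim}.
Definition Germ := {eq_quot germ_approx}.

(* sigma = [s, x] *)
Definition is_germ (sigma : Sigma) (s : S) (x : X) :=
  exists2 u : germ_pair, val u = (s, x) & sigma = \pi_Sigma u.

Definition germ_dom (sigma : Sigma) : X := (val (repr sigma)).2.

Definition germ_ran (sigma : Sigma) : X :=
  phi (val (repr sigma)).1 (val (repr sigma)).2.

(* The [xget]s below pick the unique element of a set, which in the case of
   [germ_mul sigma tau] is inhabited when [germ_dom sigma = germ_ran tau]. *)
Definition germ_mul (sigma tau : Sigma) : Sigma := xget sigma
  [set rho | exists s t x, [/\ is_germ tau t x, is_germ sigma s (phi t x) &
    is_germ rho (s * t)%g x]].

Definition germ_inv (sigma : Sigma) : Sigma := xget sigma
  [set rho | exists s x, is_germ sigma s x /\ is_germ rho (s^*)%g (phi s x)].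

(* The product of [sigma] with [theta] in the circle group. *)
Definition germ_circle (sigma : Sigma) (theta : C) : Sigma := xget sigma
  [set rho | exists s x (c : T), [/\ is_germ sigma s x, c x = theta &
    is_germ rho (s * i c)%g x]].

Definition Germ_ran (g : Germ) : X := phi (val (repr g)).1 (val (repr g)).2.

Definition Germ_lift (g : Germ) : Sigma := \pi_Sigma (repr g).

Definition bisection (s : S) : set Sigma :=
  [set sigma | exists x, is_germ sigma s x].

Definition Delta (B : set Sigma) (sigma : Sigma) : C := xget 0
  [set z | exists theta tau, [/\ `|theta| = 1, B tau,
    sigma = germ_circle tau theta & z = theta^*]].

Definition germ_conv (f g : Sigma -> C) (sigma : Sigma) : C :=
  \sum_(tau \in [set tau : Germ | Germ_ran tau = germ_ran sigma])
    f (Germ_lift tau) * g (germ_mul (germ_inv (Germ_lift tau)) sigma).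

Definition germ_star (f : Sigma -> C) (sigma : Sigma) : C :=
  (f (germ_inv sigma))^*.

Definition Cc : set (X -> C) :=
  [set b | continuous b /\ compact (closure [set x | b x != 0])].

Definition twisted_Cc : set (Sigma -> C) :=
  [set f | exists (n : nat) (s : 'I_n -> S) (b : 'I_n -> X -> C),
    (forall k, Cc (b k)) /\
    f = fun sigma => \sum_(k < n)
          Delta (bisection (s k)) sigma * b k (germ_dom sigma)].

Lemma is_germ_dom sigma s x : is_germ sigma s x -> germ_dom sigma = x.
Proof.
move=> [u ux ->]; rewrite /germ_dom.
have : germ_sim (repr (\pi_Sigma u)) u by apply/eqmodP; rewrite reprK.
by move=> /asboolP[-> _]; rewrite ux.
Qed.

Lemma is_germ_in_dom sigma s x : is_germ sigma s x -> dom s x.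
Proof. by move=> [u ux _]; have := germ_pairP u; rewrite ux. Qed.

Lemma germ_dom_circle tau theta : germ_dom (germ_circle tau theta) = germ_dom tau.
Proof.
rewrite /germ_circle; case: xgetP => // rho _ [s [x [c [tx _ rx]]]].
by rewrite (is_germ_dom tx) (is_germ_dom rx).
Qed.

Lemma Delta_off s sigma : ~ dom s (germ_dom sigma) -> Delta (bisection s) sigma = 0.
Proof.
move=> sd; rewrite /Delta; case: xgetP => // z _ [theta [tau [_ [x tx] st _]]].
case: sd; rewrite st germ_dom_circle (is_germ_dom tx); exact: is_germ_in_dom tx.
Qed.

Lemma Delta_in s : twisted_Cc (Delta (bisection s)).
Proof.
have ds : idem (p (s^* * s)%g) by rewrite /idem -gmulfM mulgA mulsK.
have cs := dual_compact (d := D) ds; have os := dual_open D ds.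
exists 1%N, (fun=> s), (fun=> circle_indicator cs os); split.
  move=> _; split; first exact: circle_continuous.
  rewrite indicator_supp -(closure_id _).1 //.
  by apply: compact_closed => //; exact: boolean_hausdorff.
apply/funext => sigma; rewrite big_ord1 /=.
have [sx|sx] := pselect (dom s (germ_dom sigma)).
  by rewrite mem_set // mulr1.
by rewrite Delta_off // mul0r.
Qed.

Definition Delta_fun (s : S) : twisted_Cc :=
  exist (fun f => f \in twisted_Cc) _ (mem_set (Delta_in s)).

End Germs.

Arguments germ_conv {R X G S D} tw f g sigma.
Arguments germ_star {R X G S D} tw f sigma.
Arguments twisted_Cc {R X G S D} tw _.
Arguments Delta_fun {R X G S D} tw s.

Section ContinuousVanishing.
Context {R : realType} {X : booleanSpaceType}.

Definition C0 : set (X -> Cplx R) :=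
  [set f | continuous f /\ forall e : Cplx R, 0 < e ->
     exists2 K : set X, compact K & forall x, ~ K x -> `|f x| < e].

Lemma circle_C0 (h : circleFun R X) : C0 h.
Proof.
split=> [|e e0]; first exact: circle_continuous.
exists (circle_supp h); first exact: circle_compact.
by move=> x /= /negP; rewrite negbK => /eqP ->; rewrite normr0.
Qed.

Definition circle_to_C0 (h : circleFun R X) : C0 :=
  exist (fun f => f \in C0) _ (mem_set (circle_C0 h)).

End ContinuousVanishing.

Definition Cc_rep (R : realType) (X : booleanSpaceType) (G S : invSemigroupType)
    (D : dualSpace X G) (tw : twist R S D) (K : hilbertType R)
    (rho : twisted_Cc tw -> boundedOp K) : Prop :=
  star_rep (germ_conv tw) (germ_star tw) rho.

(* [rho] is the extension to C_0(X) of the restriction of [pi] to B(X); the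
   idempotents of T(X) are the indicator functions of compact open sets. *)
Definition C0_extension (R : realType) (X : booleanSpaceType)
    (G S : invSemigroupType) (D : dualSpace X G) (tw : twist R S D)
    (K : hilbertType R) (pi : S -> boundedOp K) (rho : C0 -> boundedOp K) : Prop :=
  star_rep (fun f g (x : X) => f x * g x) (fun f (x : X) => (f x)^*) rho /\
  forall h, idem h -> rho (circle_to_C0 h) = pi (tw_i tw h).

Record twist_rep (R : realType) (X : booleanSpaceType) (G S : invSemigroupType)
    (D : dualSpace X G) (tw : twist R S D) (K : hilbertType R)
    (pi : S -> boundedOp K) : Prop := TwistRep {
  twist_repM : forall s t u, pi (s * t)%g u = pi s (pi t u) ;
  twist_repJ : forall s u v, hdot (pi (s^*)%g u) v = hdot u (pi s v) ;
  twist_rep_join : forall s t j, orthogonal_pair s t -> is_join s t j ->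
    forall u, pi j u = pi s u + pi t u ;
  twist_rep0 : forall u, pi izero u = 0 ;
  twist_rep_circle : exists2 rho, C0_extension tw pi rho &
    forall h, pi (tw_i tw h) = rho (circle_to_C0 h)
}.

(* Main.v *)
(** On the unit space X, a representation of Cc(X) is contractive for the uniform
    norm (M^2 1_U - |b|^2 has a continuous square root), so it is determined by its
    values on step functions and extends to C0(X); this gives both the extension
    required of a representation of the twist and, as Delta_S b is the convolution
    of Delta_S with the function b on the unit space, the injectivity of the
    correspondence.

    Conversely, a representation pi of the twist with extension rho to C0(X) has to
    be sent to sum_j Delta_(s_j) b_j |-> sum_j pi(s_j) rho(b_j), and the point is
    that this is well defined, although G may fail to be Hausdorff.  Suppose that
    sum_j Delta_(s_j) b_j = 0.  Near a point x each s_j agrees, up to a factor in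
    T(X), with a fixed representative of its germ at x; collecting terms rewrites
    the operator as sum_l pi(s_l) rho(g_l) where g_l(x) is, up to a phase, a value
    of the zero function, so that |g_l| <= e near x.  The bound |g_l| <= e survives
    disjoint unions of compact open sets, hence holds globally by compactness, and
    the norm of the operator is at most e times the number of terms. *)

Require Import Defs.
From mathcomp Require Import all_boot all_order all_algebra.
From mathcomp Require Import all_classical all_reals all_analysis.
From mathcomp Require Import complex generic_quotient ring.

Set Implicit Arguments.
Unset Strict Implicit.
Unset Printing Implicit Defensive.

Import Order.TTheory GRing.Theory Num.Theory.
Import numFieldNormedType.Exports.

Local Open Scope classical_set_scope.
Local Open Scope ring_scope.
Local Open Scope quotient_scope.

(** * Compact open sets in Boolean spaces *)

(** The number of terms must not grow with the cover. When the sum is rewritten near a point, its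
    terms are regrouped over the original index set [J]; pieces of X then only add coefficients with
    disjoint supports, so that neither the number of terms nor the bound e is affected by how many
    pieces a given e requires. This is why everything is done with compact open sets, which can be
    made disjoint.

    The homeomorphisms [phi s] are never studied through their definition by duality. Domain,
    injectivity, continuity and composition are all extracted from the twist axiom that s h s^* is h
    composed with the inverse of [phi s], tested on T(X), which separates points. Equality of germs
    is also an equation in S, of the form t a = s c with a, c in T(X), so computing with [Delta]
    amounts to moving elements of T(X) past elements of S.

    Multiplicativity of the constructed representation rests on one commutation rule, rho(b) pi(t) =
    pi(t) rho(b o phi_t). *)

(** If [Q A] failed, the sets B with [Q (A \ B)] would form a proper filter containing A, and a
    cluster point of it in A would contradict the local hypothesis there. *)
Lemma compact_ind (T : topologicalType) (Q : set T -> Prop) (A : set T) :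
  compact A -> Q set0 -> (forall M N, M `<=` N -> Q N -> Q M) ->
  (forall M N, Q M -> Q N -> Q (M `|` N)) ->
  (forall x, A x -> exists2 N, nbhs x N & Q N) -> Q A.
Proof.
move=> cA Q0 Qs QU Ql; apply: contrapT => nQ.
pose F : set_system T := fun B => Q (A `\` B).
have FF : ProperFilter F.
  split; first by rewrite /F setD0.
  split; rewrite /F.
  - by rewrite setDT.
  - by move=> P P' FP FP'; rewrite setDIr; apply: QU.
  - by move=> P P' PP'; apply: Qs; apply: setDS.
have [|x [Ax clx]] := cA F FF; first by rewrite /F setDv.
have [N xN QN] := Ql x Ax.
have [|y [nNy Ny]] := clx (~` N) N _ xN; last exact: nNy.
by apply: Qs QN => z [_ /contrapT].
Qed.

Definition copen (T : topologicalType) (U : set T) := compact U /\ open U.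

Section BooleanSpaces.
Context {X : booleanSpaceType}.
Implicit Types (x y : X) (U V W A B O : set X).

Lemma copen_closed U : copen U -> closed U.
Proof. by case=> cU _; apply: compact_closed => //; exact: boolean_hausdorff. Qed.

Lemma copen0 : @copen X set0.
Proof. by split; [exact: compact0|exact: open0]. Qed.

Lemma copenU U V : copen U -> copen V -> copen (U `|` V).
Proof. by move=> [? ?] [? ?]; split; [exact: compactU|exact: openU]. Qed.

Lemma copenI U V : copen U -> copen V -> copen (U `&` V).
Proof.
move=> [cU oU] Vco; split; last exact: openI Vco.2.
by apply: compact_closedI => //; exact: copen_closed.
Qed.

Lemma copenD U V : copen U -> copen V -> copen (U `\` V).
Proof.
move=> [cU oU] Vco; rewrite setDE; split.
  by apply: compact_closedI => //; apply: open_closedC; exact: Vco.2.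
by apply: openI => //; apply: closed_openC; exact: copen_closed.
Qed.

Lemma separate_point_compact A y : compact A -> ~ A y ->
  exists U V, [/\ open U, open V, A `<=` U, V y & U `&` V = set0].
Proof.
move=> cA nAy.
apply: (@compact_ind X (fun N => exists U V,
  [/\ open U, open V, N `<=` U, V y & U `&` V = set0])) => //.
- by exists set0, setT; split=> //; [exact: open0|exact: openT|rewrite set0I].
- by move=> M N MN [U [V [oU oV NU Vy UV]]]; exists U, V; split=> //; exact: subset_trans NU.
- move=> M N [U [V [oU oV MU Vy UV]]] [U' [V' [oU' oV' NU Vy' UV']]].
  exists (U `|` U'), (V `&` V'); split=> //; [exact: openU|exact: openI|exact: setUSS|].
  by rewrite setIUl setIA UV set0I set0U setICA UV' setI0.
- move=> x Ax; have xy : x != y by apply: contra_notN nAy => /eqP <-.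
  have := @boolean_hausdorff X; rewrite open_hausdorff => /(_ x y xy).
  move=> [[U V] /= [/[!inE] Ux Vy] [oU oV /eqP UV]].
  exists U; first exact: open_nbhs_nbhs.
  by move=> /=; exists U, V; split=> //; exact/eqP.
Qed.

Lemma separate_compact A B : compact A -> compact B -> A `&` B = set0 ->
  exists U V, [/\ open U, open V, A `<=` U, B `<=` V & U `&` V = set0].
Proof.
move=> cA cB AB.
suff [U [V [? ? ? ? ?]]] : exists V U, [/\ open V, open U, B `<=` V, A `<=` U & V `&` U = set0].
  by move=> /=; exists V, U; split=> //; rewrite setIC.
apply: (@compact_ind X (fun N => exists U V,
  [/\ open U, open V, N `<=` U, A `<=` V & U `&` V = set0])) => //.
- by exists set0, setT; split=> //; [exact: open0|exact: openT|rewrite set0I].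
- by move=> M N MN [U [V [oU oV NU Vy UV]]]; exists U, V; split=> //; exact: subset_trans NU.
- move=> M N [U [V [oU oV MU Vy UV]]] [U' [V' [oU' oV' NU Vy' UV']]].
  exists (U `|` U'), (V `&` V'); split=> //; [exact: openU|exact: openI|exact: setUSS| |].
    by rewrite subsetI.
  by rewrite setIUl setIA UV set0I set0U setICA UV' setI0.
- move=> x Bx; have nAx : ~ A x by move=> Ax; rewrite -[False]/(set0 x) -AB.
  have [U [V [oU oV AU Vx UV]]] := separate_point_compact cA nAx.
  exists V; first exact: open_nbhs_nbhs.
  by move=> /=; exists V, U; split=> //; rewrite setIC.
Qed.

(** Finite intersection property in directed form: a point of N outside O is missed by some closed C
    in F, hence so is a neighbourhood, and directedness absorbs finite unions of such
    neighbourhoods. *)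
Lemma directed_compact_sub (N O : set X) (F : set (set X)) :
  compact N -> open O -> F !=set0 ->
  (forall C C', F C -> F C' -> F (C `&` C')) -> (forall C, F C -> closed C) ->
  (forall y, N y -> (forall C, F C -> C y) -> O y) ->
  exists2 C, F C & N `&` C `<=` O.
Proof.
move=> cN oO [C0 FC0] FI Fc NO.
apply: (@compact_ind X (fun M => exists2 C, F C & M `&` C `<=` O)) => //.
- by exists C0 => //; rewrite set0I.
- by move=> M M' MM' [C FC CO]; exists C => // z [/MM' Mz Cz]; apply: CO.
- move=> M M' [C FC CO] [C' FC' CO']; exists (C `&` C'); first exact: FI.
  by move=> z [[Mz|Mz] [Cz Cz']]; [apply: CO|apply: CO'].
- move=> y Ny; have [Oy|nOy] := pselect (O y).
    by exists O; [exact: open_nbhs_nbhs|exists C0 => // z []].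
  have /existsNP[C /not_implyP[FC nCy]] : ~ forall C, F C -> C y.
    by move=> H; apply: nOy; exact: NO.
  exists (~` C); first by apply: open_nbhs_nbhs; split=> //; apply: closed_openC; exact: Fc.
  by exists C => // z [].
Qed.

(** Total disconnectedness only speaks of connected components. In the compact neighbourhood N the
    component of x is the intersection Q of the relatively clopen sets containing x; since this is a
    point, one such set already lies in the interior of [N & O], and is then open in X. *)
Lemma boolean_base x O : nbhs x O -> exists U, [/\ copen U, U x & U `<=` O].
Proof.
move=> xO.
have [N xN [cN clN]] : exists2 N, nbhs x N & compact N /\ closed N.
  have [N nN cN] := @boolean_locally_compact X x I.
  have {}nN : nbhs x [set z | setT z -> N z] by exact: nN.
  by exists N => //; apply: filterS nN => z; apply.
(* x is the only point common to all relatively clopen sets of N that contain x. *)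
pose F : set (set X) := fun C => [/\ C `<=` N, C x, closed C & closed (N `\` C)].
have FN : F N by split=> //; [exact: nbhs_singleton|rewrite setDv; exact: closed0].
have FI C C' : F C -> F C' -> F (C `&` C').
  move=> [CN Cx cC cNC] [C'N C'x cC' cNC']; split=> //; first by move=> z [/CN].
    exact: closedI.
  by rewrite setDIr; exact: closedU.
have Fc C : F C -> closed C by case.
pose Q := \bigcap_(C in F) C.
have Qx : Q x by move=> C [].
have clQ : closed Q by apply: closed_bigI => C /Fc.
have cQ : compact Q by apply: (subclosed_compact clQ cN); move=> z /(_ N FN).
(* If Q is the disjoint union of the closed sets B and [Q \ B], separate them by U and V. Some C in
   F lies inside the union of U and V, so [C & U] is again relatively clopen and contains x; hence Q
   lies in U. *)
have half B : closed B -> closed (Q `\` B) -> B x -> B `<=` Q -> Q `<=` B.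
  move=> cB cQB Bx BQ.
  have [U [V [oU oV BU QV UV]]] : exists U V,
      [/\ open U, open V, B `<=` U, Q `\` B `<=` V & U `&` V = set0].
    apply: separate_compact; [exact: (subclosed_compact cB cQ)| |by rewrite setDIK].
    by apply: (subclosed_compact cQB cQ) => z [].
  have [||C FC CUV] := @directed_compact_sub N (U `|` V) F cN (openU oU oV) _ FI Fc.
  - by exists N.
  - move=> y Ny Qy; have [By|nBy] := pselect (B y); first by left; exact: BU.
    by right; apply: QV; split.
  have [CN Cx cC cNC] := FC.
  have UVF z : U z -> V z -> False.
    by move=> Uz Vz; have : set0 z by rewrite -UV.
  have CUV' z : C z -> U z \/ V z by move=> Cz; apply: CUV; split=> //; exact: CN.
  have FCU : F (C `&` U).
    split; [by move=> z [/CN]|by split=> //; exact: BU| |].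
      have -> : C `&` U = C `&` ~` V.
        apply/seteqP; split=> z [Cz]; first by move=> Uz; split=> // Vz; exact: (UVF z).
        by move=> nVz; split=> //; have [//|/nVz] := CUV' z Cz.
      by apply: closedI => //; exact: open_closedC.
    have -> : N `\` (C `&` U) = (N `\` C) `|` (C `&` ~` U).
      apply/seteqP; split=> z.
        move=> [Nz]; have [Cz|nCz] := pselect (C z); last by left; split.
        by move=> nCU; right; split=> // Uz; apply: nCU.
      by move=> [[Nz nCz]|[Cz nUz]]; split=> //; [case|exact: CN|case].
    by apply: closedU => //; apply: closedI => //; exact: open_closedC.
  move=> z Qz; apply: contrapT => nBz.
  have [_ Uz] := Qz _ FCU.
  by apply: (UVF z Uz); apply: QV.
have conQ : connected Q.
  move=> B [b Bb] [W1 oW1 BW1] [C1 cC1 BC1].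
  have BQ : B `<=` Q.
    by move=> z; rewrite BW1 => -[].
  have cB : closed B by rewrite BC1; exact: closedI.
  have cQB : closed (Q `\` B).
    have -> : Q `\` B = Q `&` ~` W1.
      apply/seteqP; split=> z [Qz]; rewrite BW1; first by move=> H; split=> // Oz; apply: H.
      by move=> nOz; split=> // -[].
    by apply: closedI => //; exact: open_closedC.
  apply/seteqP; split=> //.
  have [Bx|nBx] := pselect (B x); first exact: half.
  (* When x is outside B, [half] applied to the other piece makes B empty, against b. *)
  have QQB : Q `<=` Q `\` B.
    by apply: half; [|rewrite setDD setIidr| |move=> z []].
  by have [] := QQB b (BQ b Bb).
have Qx1 : Q = [set x].
  apply/seteqP; split; last by move=> z ->.
  rewrite -(@boolean_totally_disconnected X x I).
  exact: connected_component_max.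
have [||C FC CO] := @directed_compact_sub N (interior (N `&` O)) F cN (@open_interior _ _) _ FI Fc.
- by exists N.
- move=> y Ny Qy; have : Q y by move=> C FC; exact: Qy.
  by rewrite Qx1 => ->; rewrite /interior; exact: filterI.
have [CN Cx cC cNC] := FC.
have CO' : C `<=` interior (N `&` O) by move=> z Cz; apply: CO; split=> //; exact: CN.
exists C; split=> //; last by move=> z /CO'/interior_subset[].
split; first exact: (subclosed_compact cC cN).
have -> : C = interior (N `&` O) `&` ~` (N `\` C).
  apply/seteqP; split=> z; first by move=> Cz; split; [exact: CO'|case].
  by move=> [/interior_subset[Nz _] nNC]; apply: contrapT => nCz; apply: nNC.
by apply: openI; [exact: open_interior|exact: closed_openC].
Qed.

Lemma compact_in_open A : compact A -> exists2 V, copen V & A `<=` V.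
Proof.
move=> cA; apply: (@compact_ind X (fun A => exists2 V, copen V & A `<=` V)) => //.
- by exists set0 => //; exact: copen0.
- by move=> M N MN [V cV NV]; exists V => //; exact: subset_trans NV.
- move=> M N [V cV NV] [V' cV' NV']; exists (V `|` V'); first exact: copenU.
  exact: setUSS.
- move=> x _; have [U [Uco Ux _]] := @boolean_base x setT filterT.
  by exists U; [apply: open_nbhs_nbhs; split=> //; case: Uco|exists U].
Qed.

(** Only disjoint unions remain to be handled, because W can be cut into the compact open sets
    [W & U] and [W \ U]. The pieces are not known in advance, so the local hypothesis must cover all
    compact open subsets of U. *)
Lemma copen_ind (Q : set X -> Prop) V : copen V -> Q set0 ->
  (forall x, V x -> exists2 U, nbhs x U & forall W, copen W -> W `<=` U -> Q W) ->
  (forall W W', copen W -> copen W' -> W `&` W' = set0 ->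
    Q W -> Q W' -> Q (W `|` W')) -> Q V.
Proof.
move=> Vco Q0 Ql QU.
have [||||U Uco [VU]] := @compact_ind X (fun M => exists2 U, copen U &
  M `<=` U /\ forall W, copen W -> W `<=` U -> Q W) V Vco.1.
- exists set0; first exact: copen0.
  by split=> // W _; rewrite subset0 => ->.
- by move=> M N MN [U Uco [NU UQ]]; exists U => //; split=> //; exact: subset_trans NU.
- move=> M N [U Uco [MU UQ]] [U' U'co [NU' UQ']]; exists (U `|` U'); first exact: copenU.
  split; first exact: setUSS.
  move=> W Wco WU; have -> : W = (W `&` U) `|` (W `\` U) by rewrite setUIDK.
  apply: QU; [exact: copenI|exact: copenD|by apply/seteqP; split=> z // [[_ Uz] []]| |].
  - by apply: UQ; [exact: copenI|move=> z []].
  - by apply: UQ'; [exact: copenD|move=> z [/WU[]]].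
- move=> x Vx; have [U xU UQ] := Ql x Vx.
  have [U' [U'co U'x U'U]] := boolean_base xU.
  exists U'; first by apply: open_nbhs_nbhs; split=> //; case: U'co.
  by exists U' => //; split=> // W Wco WU'; apply: UQ => //; exact: subset_trans WU' U'U.
- by apply.
Qed.

End BooleanSpaces.

(** * Compactly supported continuous functions *)

Section CompactSupport.
Context {R : realType} {X : booleanSpaceType}.
Local Notation C := (Cplx R).
Implicit Types (x y : X) (U V W : set X) (b c f g : X -> C).

Definition ind U : X -> C := fun x => (x \in U)%:R.

Lemma ind1 U x : U x -> ind U x = 1. Proof. by move=> Ux; rewrite /ind mem_set. Qed.

Lemma ind0 U x : ~ U x -> ind U x = 0. Proof. by move=> Ux; rewrite /ind memNset. Qed.

(** A compact support can be enlarged to a compact open set, which is easier to combine than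
    closures of supports. *)
Lemma CcP b : Cc b <->
  continuous b /\ exists2 V, copen V & forall x, ~ V x -> b x = 0.
Proof.
split=> -[cb].
  move=> cK; split=> //; have [V Vco KV] := compact_in_open cK.
  exists V => // x nVx; apply: contra_notP nVx => /eqP bx.
  by apply: KV; apply: subset_closure.
move=> [V Vco bV]; split=> //.
apply: (subclosed_compact (@closed_closure _ _) Vco.1).
rewrite [X in _ `<=` X](closure_id _).1; last exact: copen_closed.
apply: closure_subset => x /= bx; apply: contrapT => /bV bx0.
by rewrite bx0 eqxx in bx.
Qed.

Lemma Cc_ind U : copen U -> Cc (ind U).
Proof.
move=> Uco; apply/CcP; split; first exact: indicator_continuous Uco.1 Uco.2.
by exists U => // x /ind0.
Qed.

Lemma CcD b c : Cc b -> Cc c -> Cc (fun x => b x + c x).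
Proof.
move=> /CcP[cb [V Vco bV]] /CcP[cc [W Wco cW]]; apply/CcP; split.
  by move=> x; apply: cvgD; [exact: cb|exact: cc].
exists (V `|` W); first exact: copenU.
by move=> x /not_orP[/bV -> /cW ->]; rewrite addr0.
Qed.

Lemma CcMl f b : continuous f -> Cc b -> Cc (fun x => f x * b x).
Proof.
move=> cf /CcP[cb [V Vco bV]]; apply/CcP; split.
  by move=> x; apply: cvgM; [exact: cf|exact: cb].
by exists V => // x /bV ->; rewrite mulr0.
Qed.

Lemma CcMr f b : continuous f -> Cc b -> Cc (fun x => b x * f x).
Proof.
move=> cf Cb; rewrite (_ : (fun x => _) = (fun x => f x * b x)); first exact: CcMl.
by apply/funext => x; rewrite mulrC.
Qed.

Lemma CcM b c : Cc b -> Cc c -> Cc (fun x => b x * c x).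
Proof. by move=> [cb _]; exact: CcMl. Qed.

Lemma CcZ (k : C) b : Cc b -> Cc (fun x => k * b x).
Proof. by apply: (@CcMl (fun=> k)) => x; exact: cvg_cst. Qed.

Lemma CcN b : Cc b -> Cc (fun x => - b x).
Proof.
by move=> /(CcZ (-1)); congr Cc; apply/funext => x; rewrite mulN1r.
Qed.

Lemma CcB b c : Cc b -> Cc c -> Cc (fun x => b x - c x).
Proof. by move=> Cb /CcN; exact: CcD. Qed.

Lemma Cc0 : Cc (fun _ : X => 0 : C).
Proof.
apply/CcP; split; first by move=> x; exact: cvg_cst.
by exists set0 => //; exact: copen0.
Qed.

Lemma Cc_sum_seq (J : Type) (s : seq J) (P : pred J) (b : J -> X -> C) :
  (forall j, Cc (b j)) -> Cc (fun x => \sum_(j <- s | P j) b j x).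
Proof.
move=> Cb; elim: s => [|j s IH].
  by rewrite (_ : (fun x => _) = (fun=> 0)); [exact: Cc0|apply/funext => x; rewrite big_nil].
rewrite (_ : (fun x => _) =
    if P j then (fun x => b j x + \sum_(i <- s | P i) b i x)
    else (fun x => \sum_(i <- s | P i) b i x)); last first.
  by apply/funext => x; rewrite big_cons; case: (P j).
by case: (P j) => //; exact: CcD.
Qed.

Lemma Cc_sum (J : finType) (P : pred J) (b : J -> X -> C) :
  (forall j, Cc (b j)) -> Cc (fun x => \sum_(j | P j) b j x).
Proof. exact: Cc_sum_seq. Qed.

Lemma continuous_conj f : continuous f -> continuous (fun x => (f x)^*).
Proof.
move=> cf x; apply/cvgrPdist_lt => e e0.
have /cvgrPdist_lt/(_ e e0) := cf x.
by apply: filterS => y; rewrite -rmorphB norm_conjC.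
Qed.

Lemma Cc_conj b : Cc b -> Cc (fun x => (b x)^*).
Proof.
move=> /CcP[cb [V Vco bV]]; apply/CcP; split; first exact: continuous_conj.
by exists V => // x /bV ->; rewrite conjC0.
Qed.

Lemma CcI U b : copen U -> Cc b -> Cc (fun x => ind U x * b x).
Proof. by move=> /Cc_ind; exact: CcM. Qed.

Lemma Cc_circle (h : circleFun R X) : Cc h.
Proof.
split; first exact: circle_continuous.
rewrite -(closure_id _).1; first exact: circle_compact.
by apply: compact_closed; [exact: boolean_hausdorff|exact: circle_compact].
Qed.

Lemma Cc_C0 b : Cc b -> C0 b.
Proof.
move=> /CcP[cb [V Vco bV]]; split=> // e e0.
by exists V; [case: Vco|move=> x /bV ->; rewrite normr0].
Qed.

Lemma continuous_near_le f x (e : C) : continuous f -> 0 < e ->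
  nbhs x [set y | `|f y - f x| <= e].
Proof.
move=> cf e0; have /cvgrPdist_le/(_ e e0) := cf x.
by apply: filterS => y /=; rewrite distrC.
Qed.

(* The step functions are uniformly dense. *)
Lemma Cc_density (P : (X -> C) -> Prop) :
  (forall U, copen U -> P (ind U)) ->
  (forall b c, Cc b -> Cc c -> P b -> P c -> P (fun x => b x + c x)) ->
  (forall (k : C) b, Cc b -> P b -> P (fun x => k * b x)) ->
  (forall b, Cc b -> (forall e : C, 0 < e -> exists c,
    [/\ Cc c, P c & forall x, `|b x - c x| <= e]) -> P b) ->
  forall b, Cc b -> P b.
Proof.
move=> P1 PD PZ Plim b Cb; apply: (Plim b) => // e e0.
have [cb [V Vco bV]] := (CcP b).1 Cb.
(* Vanishing outside the set is part of the invariant, so that approximants on disjoint sets can be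
   added without disturbing each other. *)
suff [c [Cc_c Pc cV bc]] : exists c, [/\ Cc c, P c, forall x, ~ V x -> c x = 0 &
    forall x, V x -> `|b x - c x| <= e].
  exists c; split=> // x; have [/bc//|nVx] := pselect (V x).
  by rewrite bV // cV // subrr normr0 ltW.
apply: (@copen_ind X (fun W => exists c, [/\ Cc c, P c,
  forall x, ~ W x -> c x = 0 & forall x, W x -> `|b x - c x| <= e])) => //.
- exists (ind set0); split; [exact/Cc_ind/copen0|exact/P1/copen0| |by move=> x []].
  by move=> x; exact: ind0.
- move=> x Vx; exists [set y | `|b y - b x| <= e]; first exact: continuous_near_le.
  move=> W Wco WU; exists (fun y => b x * ind W y); split.
  + by apply: CcZ; exact: Cc_ind.
  + by apply: PZ; [exact: Cc_ind|exact: P1].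
  + by move=> y nWy; rewrite ind0 // mulr0.
  + by move=> y Wy; rewrite ind1 // mulr1; exact: WU.
- move=> W W' Wco W'co WW' [c [Cc_c Pc cW bc]] [c' [Cc' Pc' cW' bc']].
  have disj y : W y -> W' y -> False.
    by move=> Wy W'y; rewrite -[False]/(set0 y) -WW'.
  exists (fun y => c y + c' y); split; [exact: CcD|exact: PD| |].
  + by move=> y /not_orP[nW nW']; rewrite cW // cW' // addr0.
  + move=> y [Wy|W'y].
      by rewrite [c' y]cW' ?addr0; [exact: bc|exact: disj].
    by rewrite [c y]cW ?add0r; [exact: bc'|move=> /disj; apply].
Qed.

Lemma Cc_bounded b : Cc b -> exists2 M : C, 0 <= M & forall x, `|b x| <= M.
Proof.
move: b; apply: (@Cc_density (fun b => exists2 M : C, 0 <= M & forall x, `|b x| <= M)).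
- move=> U _; exists 1 => // x; rewrite /ind; case: (x \in U); rewrite ?normr1 ?normr0 //.
- move=> b c _ _ [M M0 bM] [N N0 cN]; exists (M + N); first exact: addr_ge0.
  by move=> x; apply: (le_trans (ler_normD _ _)); exact: lerD.
- move=> k b _ [M M0 bM]; exists (`|k| * M); first exact: mulr_ge0.
  by move=> x; rewrite normrM ler_wpM2l.
- move=> b _ /(_ 1 ltr01)[c [_ [M M0 cM] bc]]; exists (1 + M); first exact: addr_ge0.
  by move=> x; rewrite -(subrK (c x) (b x)); apply: (le_trans (ler_normD _ _)); exact: lerD.
Qed.

(** The right-hand side is the difference of the roots times their sum, and the sum dominates the
    difference. This gives continuity of the square root at 0 and elsewhere alike. *)
Lemma sqrtC_dist (a b : C) : 0 <= a -> 0 <= b -> `|sqrtC a - sqrtC b| ^+ 2 <= `|a - b|.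
Proof.
move=> a0 b0; rewrite -{2}(sqrtCK a) -{2}(sqrtCK b) subr_sqr normrM expr2.
rewrite ler_wpM2l //.
rewrite [leRHS]ger0_norm ?addr_ge0 ?sqrtC_ge0 //.
apply: (le_trans (ler_normB _ _)).
by rewrite !ger0_norm ?sqrtC_ge0.
Qed.

Lemma continuous_sqrtC f : continuous f -> (forall x, 0 <= f x) ->
  continuous (fun x => sqrtC (f x)).
Proof.
move=> cf f0 x; apply/cvgrPdist_lt => e e0.
have e20 : 0 < e ^+ 2 by rewrite exprn_gt0.
have /cvgrPdist_lt/(_ _ e20) := cf x.
apply: filterS => y fxy.
rewrite -(@ltr_pXn2r _ 2) ?nnegrE ?normr_ge0 ?(ltW e0) //.
exact: le_lt_trans (sqrtC_dist (f0 x) (f0 y)) fxy.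
Qed.

End CompactSupport.

(** * Representations of Cc(X) and their extension to C0(X) *)

Section Operators.
Context {R : realType} {K : hilbertType R}.
Local Notation C := (Cplx R).
Implicit Types (u v w : K).

Lemma boundedOpP (a b : boundedOp K) : (forall u, a u = b u) -> a = b.
Proof.
case: a b => [a la ba] [b lb bb] /= /funext ab; subst b.
by congr BoundedOp; exact: Prop_irrelevance.
Qed.

Lemma hdotC u v : hdot u v = (hdot v u)^*.
Proof. by rewrite hermC expr0 mul1r. Qed.

Lemma hdotZl (k : C) u v : hdot (k *: u) v = k * hdot u v.
Proof. exact: (linearZl_LR (@hdot R K) v k u). Qed.

Lemma hdot_ge0 u : 0 <= hdot u u.
Proof. by rewrite -hdot_norm exprn_ge0. Qed.

Lemma hdot_CauchySchwarz u v : `|hdot u v| <= `|u| * `|v|.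
Proof.
have [->|v0] := eqVneq v 0; first by rewrite linear0r !normr0 mulr0.
have vv0 : `|v| != 0 by rewrite normr_eq0.
rewrite -(@ler_pXn2r _ 2) ?nnegrE ?mulr_ge0 //.
(* The coefficient of the orthogonal projection of u on v. *)
pose a := hdot u v / `|v| ^+ 2.
have := hdot_ge0 (u - a *: v).
rewrite linearBl /= !linearBr /= !linearZl_LR /= !linearZr_LR /=.
rewrite -!hdot_norm (hdotC v u) /a.
set z := hdot u v.
have zz : z^* * z = `|z| ^+ 2 by rewrite normCK mulrC.
have cn : (z / `|v| ^+ 2)^* = z^* / `|v| ^+ 2.
  by rewrite rmorphM /= fmorphV /= rmorphXn /= (CrealP (normr_real v)).
rewrite cn => H.
suff E : `|u| ^+ 2 - `|z| ^+ 2 / `|v| ^+ 2 = `|u| ^+ 2 - z^* / `|v| ^+ 2 * z -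
   (z * (`|v| ^- 2 * z^*) - z * ((z^* / `|v| ^+ 2) * (`|v| ^- 2 * `|v| ^+ 2))).
  have : 0 <= `|u| ^+ 2 - `|z| ^+ 2 / `|v| ^+ 2 by rewrite E; exact: H.
  by rewrite subr_ge0 ler_pdivrMr ?exprn_gt0 ?normr_gt0 // exprMn.
by rewrite mulVf ?expf_neq0 // mulr1 (mulrC (`|v| ^- 2)) subrr subr0 -zz mulrAC.
Qed.

(** The restriction [e <= 1] lets a product of two approximants, whose error is quadratic in e, be
    estimated linearly. *)
Lemma eq_arbitrarily_close u v (M : C) : 0 <= M ->
  (forall e : C, 0 < e -> e <= 1 -> `|u - v| <= e * M) -> u = v.
Proof.
move=> M0 H; apply/eqP; rewrite -subr_eq0 -normr_eq0 eq_le normr_ge0 andbT.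
apply/ler_addgt0Pr => e e0; rewrite add0r.
have eM : 0 < e + (M + 1) by rewrite addr_gt0 // ltr_wpDl.
(* This number is at most 1, and its product with M is at most e. *)
have := H (e / (e + (M + 1))); rewrite divr_gt0 // ler_pdivrMr // mul1r lerDl.
rewrite addr_ge0 // => /(_ isT isT)/le_trans; apply.
rewrite mulrAC ler_pdivrMr // ler_pM2l //.
by rewrite addrCA lerDl addr_ge0 // ltW.
Qed.

End Operators.

Section CcRepresentations.
Context {R : realType} {X : booleanSpaceType} {K : hilbertType R}.
Local Notation C := (Cplx R).
Implicit Types (u v w : K) (b c f g : X -> C).

(** Total functions on [X -> C] spare the membership proofs that a representation on a subtype
    carries; the algebraic laws are asked on [Cc] only. Boundedness is derived, in [Cc_op_bound]. *)
Record Cc_op (r : (X -> C) -> K -> K) : Prop := CcOp {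
  Cc_opL : forall b, linear (r b) ;
  Cc_opD : forall b c, Cc b -> Cc c -> forall u, r (fun x => b x + c x) u = r b u + r c u ;
  Cc_opZ : forall (k : C) b, Cc b -> forall u, r (fun x => k * b x) u = k *: r b u ;
  Cc_opM : forall b c, Cc b -> Cc c -> forall u, r (fun x => b x * c x) u = r b (r c u) ;
  Cc_opJ : forall b, Cc b -> forall u v, hdot (r (fun x => (b x)^*) u) v = hdot u (r b v)
}.

Variable r : (X -> C) -> K -> K.
Hypothesis rP : Cc_op r.

Lemma Cc_op_vD b u v : r b (u + v) = r b u + r b v.
Proof. by have := Cc_opL rP b 1 u v; rewrite !scale1r. Qed.

Lemma Cc_op_v0 b : r b 0 = 0.
Proof. by apply: (@addrI _ (r b 0)); rewrite -Cc_op_vD !addr0. Qed.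

Lemma Cc_op_vZ b k u : r b (k *: u) = k *: r b u.
Proof. by have := Cc_opL rP b k u 0; rewrite Cc_op_v0 !addr0. Qed.

Lemma Cc_op_vB b u v : r b (u - v) = r b u - r b v.
Proof. by rewrite -scaleN1r Cc_op_vD Cc_op_vZ scaleN1r. Qed.

Lemma Cc_op_vsum b (J : Type) (s : seq J) (P : pred J) (z : J -> K) :
  r b (\sum_(j <- s | P j) z j) = \sum_(j <- s | P j) r b (z j).
Proof.
elim/big_rec2: _ => [|j y1 y2 _ <-]; [exact: Cc_op_v0|exact: Cc_op_vD].
Qed.

Lemma Cc_op0 u : r (fun=> 0) u = 0.
Proof.
have := Cc_opZ rP 0 (@Cc0 R X) u; rewrite scale0r => <-.
by congr (r _ u); apply/funext => x; rewrite mul0r.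
Qed.

Lemma Cc_opB b c u : Cc b -> Cc c -> r (fun x => b x - c x) u = r b u - r c u.
Proof.
move=> Cb Cc_c; rewrite -scaleN1r -(Cc_opZ rP _ Cc_c) -(Cc_opD rP Cb (CcZ _ Cc_c)).
by congr (r _ u); apply/funext => x; rewrite mulN1r.
Qed.

Lemma Cc_op_sum (J : finType) (P : pred J) (b : J -> X -> C) u :
  (forall j, Cc (b j)) -> r (fun x => \sum_(j | P j) b j x) u = \sum_(j | P j) r (b j) u.
Proof.
move=> Cb; elim: (index_enum J) => [|j s IH].
  by rewrite big_nil -[RHS](Cc_op0 u); congr (r _ u); apply/funext => x; rewrite big_nil.
rewrite big_cons -IH; case: ifP => Pj; last first.
  by congr (r _ u); apply/funext => x; rewrite big_cons Pj.
rewrite -(Cc_opD rP (Cb j) (Cc_sum_seq s P Cb)).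
by congr (r _ u); apply/funext => x; rewrite big_cons Pj.
Qed.

Lemma Cc_op_normsq b u : Cc b -> `|r b u| ^+ 2 = hdot (r (fun x => `|b x| ^+ 2) u) u.
Proof.
move=> Cb; rewrite hdot_norm -(Cc_opJ rP) // -(Cc_opM rP (Cc_conj Cb) Cb).
by congr (hdot (r _ u) u); apply/funext => x; rewrite normCK mulrC.
Qed.

Lemma Cc_op_ind_normsq U u : copen U -> `|r (ind U) u| ^+ 2 = hdot (r (ind U) u) u.
Proof.
move=> Uco; rewrite (Cc_op_normsq _ (Cc_ind Uco)).
congr (hdot (r _ u) u); apply/funext => x.
by rewrite /ind; case: (x \in U); rewrite ?normr1 ?normr0 ?expr1n ?expr0n.
Qed.

(** The operator P of an indicator is an orthogonal projection, and the squared norm of u - Pu is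
    that of u minus that of Pu. *)
Lemma Cc_op_ind_norm U u : copen U -> `|r (ind U) u| <= `|u|.
Proof.
move=> Uco; rewrite -(@ler_pXn2r _ 2) ?nnegrE ?normr_ge0 //.
have := hdot_ge0 (u - r (ind U) u).
rewrite linearBl /= !linearBr /= -!hdot_norm (hdotC u (r _ _)) -Cc_op_ind_normsq //.
by rewrite rmorphXn /= (CrealP (normr_real _)) subrr subr0 subr_ge0.
Qed.

Lemma Cc_op_bound b (M : C) u : Cc b -> 0 <= M -> (forall x, `|b x| <= M) ->
  `|r b u| <= M * `|u|.
Proof.
move=> Cb M0 bM; have [cb [V Vco bV]] := (CcP b).1 Cb.
pose g x := sqrtC (M ^+ 2 - `|b x| ^+ 2).
have Mb x : 0 <= M ^+ 2 - `|b x| ^+ 2.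
  by rewrite subr_ge0 ler_pXn2r ?nnegrE ?normr_ge0.
have cn : continuous (fun x : X => `|b x| ^+ 2).
  rewrite (_ : (fun x => _) = (fun x => b x * (b x)^*)); last first.
    by apply/funext => y; rewrite normCK.
  by move=> x; apply: cvgM; [exact: cb|exact: (continuous_conj cb)].
have cg : continuous g.
  apply: continuous_sqrtC; last exact: Mb.
  by move=> x; apply: cvgB; [exact: cvg_cst|exact: cn].
(* Outside V the root g is the constant M; cutting it by the indicator of V brings it back to
   [Cc]. *)
have Cg : Cc (fun x => ind V x * g x) by exact: CcMr cg (Cc_ind Vco).
have Cn c : Cc c -> Cc (fun x => `|c x| ^+ 2).
  move=> Cc_c; have -> : (fun x : X => `|c x| ^+ 2) = (fun x => c x * (c x)^*).
    by apply/funext => y; rewrite normCK.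
  exact: CcM Cc_c (Cc_conj Cc_c).
have CV := Cc_ind (R := R) Vco.
have H : `|r (fun x => ind V x * g x) u| ^+ 2 + `|r b u| ^+ 2 = M ^+ 2 * `|r (ind V) u| ^+ 2.
  rewrite (Cc_op_normsq _ Cg) (Cc_op_normsq _ Cb) (Cc_op_normsq _ CV) -linearDl -(Cc_opD rP (Cn _ Cg) (Cn _ Cb)).
  have -> : M ^+ 2 * hdot (r (fun x => `|ind V x : C| ^+ 2) u) u =
      hdot (M ^+ 2 *: r (fun x => `|ind V x : C| ^+ 2) u) u.
    by rewrite hdotZl.
  rewrite -(Cc_opZ rP _ (Cn _ CV)).
  congr (hdot (r _ u) u); apply/funext => x.
  have [Vx|nVx] := pselect (V x).
    rewrite ind1 // mul1r normr1 expr1n mulr1 /g.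
    by rewrite ger0_norm ?sqrtC_ge0 // sqrtCK subrK.
  by rewrite ind0 // bV // mul0r !normr0 expr0n addr0 mulr0.
rewrite -(@ler_pXn2r _ 2) ?nnegrE ?normr_ge0 ?mulr_ge0 // exprMn.
apply: (@le_trans _ _ (M ^+ 2 * `|r (ind V) u| ^+ 2)).
  by rewrite -H lerDr exprn_ge0.
by rewrite ler_wpM2l ?exprn_ge0 // ler_pXn2r ?nnegrE ?normr_ge0 // Cc_op_ind_norm.
Qed.

Lemma Cc_op_close b c (e : C) u : Cc b -> Cc c -> 0 <= e ->
  (forall x, `|b x - c x| <= e) -> `|r b u - r c u| <= e * `|u|.
Proof.
move=> Cb Cc_c e0 bc; rewrite -Cc_opB //; exact: Cc_op_bound (CcB Cb Cc_c) e0 bc.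
Qed.

End CcRepresentations.

(** * Representations of function algebras as total functions *)

Section Totalization.
Context {R : realType} {Y : Type} {K : hilbertType R}.
Local Notation C := (Cplx R).
Implicit Types (A : set (Y -> C)) (u : K).

(** Extended by the zero operator outside A, so that its argument can be rewritten along equalities
    of functions. *)
Definition total_rep A (rho : A -> boundedOp K) (f : Y -> C) u : K :=
  match pselect (A f) with
  | left Af => bop_fun (rho (exist _ f (mem_set Af)))
  | right _ => fun=> 0
  end u.

Lemma total_repE A (rho : A -> boundedOp K) (f : A) u : total_rep rho (val f) u = rho f u.
Proof.
rewrite /total_rep; case: pselect => [Af|]; last by have := set_valP f.
by congr (rho _ u); exact: val_inj.
Qed.

Lemma total_rep_exist A (rho : A -> boundedOp K) f (Af : f \in A) u :
  total_rep rho f u = rho (exist _ f Af) u.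
Proof. exact: (total_repE rho (exist _ f Af)). Qed.

Lemma total_rep_linear A (rho : A -> boundedOp K) f : linear (total_rep rho f).
Proof.
move=> k u v; rewrite /total_rep; case: pselect => [Af|_].
  exact: bop_linear.
by rewrite scaler0 addr0.
Qed.

Section StarRepresentation.
Context (A : set (Y -> C)) (m : (Y -> C) -> (Y -> C) -> Y -> C)
  (st : (Y -> C) -> Y -> C) (rho : A -> boundedOp K).
Hypothesis rhoP : star_rep m st rho.

Lemma total_repD f g h : A f -> A g -> A h -> (forall y, h y = f y + g y) ->
  forall u, total_rep rho h u = total_rep rho f u + total_rep rho g u.
Proof.
move=> Af Ag Ah hfg u; rewrite (total_rep_exist rho (mem_set Af)).
rewrite (total_rep_exist rho (mem_set Ag)) (total_rep_exist rho (mem_set Ah)).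
exact: (star_repD rhoP).
Qed.

Lemma total_repZ (k : C) f h : A f -> A h -> (forall y, h y = k * f y) ->
  forall u, total_rep rho h u = k *: total_rep rho f u.
Proof.
move=> Af Ah hf u; rewrite (total_rep_exist rho (mem_set Af)).
rewrite (total_rep_exist rho (mem_set Ah)); exact: (star_repZ rhoP).
Qed.

Lemma total_repM f g h : A f -> A g -> A h -> h = m f g ->
  forall u, total_rep rho h u = total_rep rho f (total_rep rho g u).
Proof.
move=> Af Ag Ah hfg u; rewrite (total_rep_exist rho (mem_set Af)).
rewrite (total_rep_exist rho (mem_set Ag)) (total_rep_exist rho (mem_set Ah)).
exact: (star_repM rhoP).
Qed.

Lemma total_repJ f h : A f -> A h -> h = st f ->
  forall u v, hdot (total_rep rho h u) v = hdot u (total_rep rho f v).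
Proof.
move=> Af Ah hf u v; rewrite (total_rep_exist rho (mem_set Af)).
rewrite (total_rep_exist rho (mem_set Ah)); exact: (star_repJ rhoP).
Qed.

Lemma total_rep_sum (J : Type) (s : seq J) (f : J -> Y -> C) :
  (forall l : seq J, A (fun y => \sum_(j <- l) f j y)) -> (forall j, A (f j)) ->
  forall u, total_rep rho (fun y => \sum_(j <- s) f j y) u = \sum_(j <- s) total_rep rho (f j) u.
Proof.
move=> Asum Af u; elim: s => [|j s IH].
  (* The empty sum is 0 times itself, so the scalar law sends it to 0. *)
  rewrite big_nil -(scale0r (total_rep rho (fun y => \sum_(j <- [::]) f j y) u)).
  by apply: total_repZ => // y; rewrite !big_nil mulr0.
rewrite big_cons -IH; apply: total_repD => // y; exact: big_cons.
Qed.

End StarRepresentation.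

End Totalization.

Lemma star_rep_Cc_op (R : realType) (X : booleanSpaceType) (K : hilbertType R)
    (A : set (X -> Cplx R)) (rho : A -> boundedOp K) :
  (forall b, Cc b -> A b) ->
  star_rep (fun f g (x : X) => f x * g x) (fun f (x : X) => (f x)^*) rho ->
  Cc_op (total_rep rho).
Proof.
move=> CA rhoP; split.
- exact: total_rep_linear.
- move=> b c Cb Cc_c; apply: (total_repD rhoP) => //; apply: CA => //; exact: CcD.
- move=> k b Cb; apply: (total_repZ rhoP) => //; apply: CA => //; exact: CcZ.
- move=> b c Cb Cc_c; apply: (total_repM rhoP) => //; apply: CA => //; exact: CcM.
- move=> b Cb; apply: (total_repJ rhoP) => //; apply: CA => //; exact: Cc_conj.
Qed.

(** * Extension from Cc to C0 *)

Section Extension.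
Context {R : realType} {X : booleanSpaceType} {K : hilbertType R}.
Local Notation C := (Cplx R).
Implicit Types (u v w : K) (b c f g : X -> C).

Variable r : (X -> C) -> K -> K.
Hypothesis rP : Cc_op r.

Lemma C0_approx f (e : C) : C0 f -> 0 < e ->
  exists2 V, copen V & forall x, ~ V x -> `|f x| <= e.
Proof.
move=> [_ fK] e0; have [A cA Af] := fK e e0.
have [V Vco AV] := compact_in_open cA.
by exists V => // x nVx; apply/ltW/Af => /AV.
Qed.

Lemma C0_Cc_approx f (e : C) : C0 f -> 0 < e ->
  exists2 g, Cc g & forall x, `|f x - g x| <= e.
Proof.
move=> Cf e0; have [V Vco Vf] := C0_approx Cf e0.
exists (fun x => ind V x * f x); first exact: CcMr Cf.1 (Cc_ind Vco).
move=> x; have [Vx|nVx] := pselect (V x).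
  by rewrite ind1 // mul1r subrr normr0 ltW.
by rewrite ind0 // mul0r subr0 Vf.
Qed.

Lemma C0_bounded f : C0 f -> exists2 M : C, 0 <= M & forall x, `|f x| <= M.
Proof.
move=> Cf; have [g Cg fg] := C0_Cc_approx Cf ltr01.
have [M M0 gM] := Cc_bounded Cg.
exists (1 + M); first by rewrite addr_ge0.
move=> x; rewrite -(subrK (g x) (f x)); apply: (le_trans (ler_normD _ _)).
by apply: lerD; [exact: fg|exact: gM].
Qed.

(** Characterizes the limit by its distance to all approximants at once, so every law of the
    extension follows from one approximation in [Cc]. Allowing [e = 0] pins the value down exactly
    when f is itself in [Cc]. *)
Definition C0_value f u w := forall (e : C) g, 0 <= e -> Cc g ->
  (forall x, `|f x - g x| <= e) -> `|w - r g u| <= e * `|u|.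

(* The limit is taken along the upward directed set of compact open subsets. *)
Lemma C0_value_exists f u : C0 f -> exists w, C0_value f u w.
Proof.
move=> Cf.
pose h V := fun x => ind V x * f x.
have Ch V : copen V -> Cc (h V) by move=> Vco; exact: CcMr Cf.1 (Cc_ind Vco).
pose B V : set K := [set z | exists W, [/\ copen W, V `<=` W & z = r (h W) u]].
pose F := filter_from (@copen X) B.
have FF : ProperFilter F.
  apply: filter_from_proper; last first.
    by move=> V Vco; exists (r (h V) u), V; split.
  apply: filter_from_filter; first by exists set0; exact: copen0.
  move=> V V' Vco V'co; exists (V `|` V'); first exact: copenU.
  move=> z [W [Wco VW ->]]; split; exists W; split=> //.
    by apply: subset_trans VW; exact: subsetUl.
  by apply: subset_trans VW; exact: subsetUr.
have cF : cauchy F.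
  apply: cauchy_exP => e e0.
  (* The summand 1 keeps the denominator positive when u is 0. *)
  have u0 : 0 < `|u| + 1 by rewrite ltr_wpDl.
  have d0 : 0 < e / (`|u| + 1) by rewrite divr_gt0.
  have [V Vco Vf] := C0_approx Cf d0.
  exists (r (h V) u); exists V => // z [W [Wco VW ->]].
  rewrite -ball_normE /=.
  apply: (@le_lt_trans _ _ (e / (`|u| + 1) * `|u|)); last first.
    by rewrite mulrAC ltr_pdivrMr // ltr_pM2l // ltrDl.
  apply: (Cc_op_close rP u (Ch _ Vco) (Ch _ Wco) (ltW d0)) => x.
  rewrite /h -mulrBl; have [Vx|nVx] := pselect (V x).
    by rewrite !ind1 //; [rewrite subrr mul0r normr0 ltW|exact: VW].
  rewrite (ind0 nVx) sub0r normrM normrN /ind.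
  by case: (x \in W); rewrite ?normr1 ?mul1r ?Vf // normr0 mul0r ltW.
have /cvg_ex[w /= Fw] : cvg F by exact: cauchy_cvg.
exists w => e g e0 Cg fg; apply/ler_addgt0Pr => d d0.
have [_ [V Vco gV]] := (CcP g).1 Cg.
have [V' V'co /(_ _)] : F (ball w d) by apply: Fw; exact: nbhsx_ballx.
(* V makes g vanish outside W, so that f cut to W is still e-close to g; V' brings the corresponding
   value within d of the limit. *)
pose W := V `|` V'.
have Wco : copen W by exact: copenU.
move=> /(_ (r (h W) u)); rewrite -ball_normE /= => wW.
have {}wW : `|w - r (h W) u| < d by apply: wW; exists W; split=> // x; right.
rewrite -(subrK (r (h W) u) w) -addrA addrC.
apply: (le_trans (ler_normD _ _)); apply: lerD; last exact: ltW.
apply: (Cc_op_close rP u (Ch _ Wco) Cg e0) => x; rewrite /h.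
have [Wx|nWx] := pselect (W x); first by rewrite ind1 // mul1r.
by rewrite ind0 // mul0r gV ?subrr ?normr0 // => Vx; apply: nWx; left.
Qed.

Definition C0_op f u : K := xget 0 (C0_value f u).

Lemma C0_opP f u : C0 f -> C0_value f u (C0_op f u).
Proof. by move=> Cf; exact: (xgetPex 0 (C0_value_exists u Cf)). Qed.

Lemma C0_op_Cc b u : Cc b -> C0_op b u = r b u.
Proof.
move=> Cb; apply/eqP; rewrite -subr_eq0 -normr_le0.
have := C0_opP u (Cc_C0 Cb) (lexx 0) Cb; rewrite mul0r; apply=> x.
by rewrite subrr normr0.
Qed.

Lemma dist3 u v u' v' : `|u - v| <= `|u - u'| + `|u' - v'| + `|v - v'|.
Proof.
have -> : u - v = (u - u') + (u' - v') + (v' - v) by rewrite !addrA !subrK.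
apply: (le_trans (ler_normD _ _)); rewrite [`|v' - v|]distrC lerD2r.
exact: ler_normD.
Qed.

Lemma C0_op_linear f : C0 f -> linear (C0_op f).
Proof.
move=> Cf k u v.
apply: (@eq_arbitrarily_close _ _ _ _ (`|k *: u + v| + (`|k| * `|u| + `|v|))).
  by rewrite !addr_ge0 ?mulr_ge0.
move=> e e0 _; have [g Cg fg] := C0_Cc_approx Cf e0.
have Ef w := @C0_opP f w Cf e g (ltW e0) Cg fg.
apply: (le_trans (dist3 _ _ (r g (k *: u + v)) (r g (k *: u + v)))).
rewrite subrr normr0 addr0 mulrDr; apply: lerD; first exact: Ef.
rewrite (Cc_op_vD rP) (Cc_op_vZ rP) opprD addrACA -scalerBr.
apply: (le_trans (ler_normD _ _)); rewrite mulrDr; apply: lerD; last exact: Ef.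
by rewrite normrZ mulrCA ler_wpM2l // Ef.
Qed.

Lemma C0_op_bounded f : C0 f -> exists M : C, forall u, `|C0_op f u| <= M * `|u|.
Proof.
move=> Cf; have [g Cg fg] := C0_Cc_approx Cf ltr01; have [M M0 gM] := Cc_bounded Cg.
exists (1 + M) => u; rewrite -(subrK (r g u) (C0_op f u)) mulrDl.
apply: (le_trans (ler_normD _ _)); apply: lerD.
  exact: (C0_opP u Cf ler01 Cg fg).
exact: Cc_op_bound.
Qed.

Lemma C0_opD f g h u : C0 f -> C0 g -> C0 h -> (forall x, h x = f x + g x) ->
  C0_op h u = C0_op f u + C0_op g u.
Proof.
move=> Cf Cg Ch hfg.
apply: (@eq_arbitrarily_close _ _ _ _ (2 * `|u| + (`|u| + `|u|))).
  by rewrite !addr_ge0 ?mulr_ge0.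
move=> e e0 _; have [f' Cf' ff'] := C0_Cc_approx Cf e0.
have [g' Cg' gg'] := C0_Cc_approx Cg e0.
have e20 : 0 <= e * 2 by rewrite mulr_ge0 // ltW.
apply: (le_trans (dist3 _ _ (r (fun x => f' x + g' x) u) (r (fun x => f' x + g' x) u))).
rewrite subrr normr0 addr0 mulrDr; apply: lerD.
  rewrite mulrA; apply: (C0_opP u Ch e20 (CcD Cf' Cg')) => x.
  rewrite hfg opprD addrACA mulr_natr mulr2n.
  by apply: (le_trans (ler_normD _ _)); apply: lerD; [exact: ff'|exact: gg'].
rewrite (Cc_opD rP) // opprD addrACA; apply: (le_trans (ler_normD _ _)).
rewrite mulrDr; apply: lerD; first exact: (C0_opP u Cf (ltW e0) Cf' ff').
exact: (C0_opP u Cg (ltW e0) Cg' gg').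
Qed.

Lemma C0_opZ (k : C) f h u : C0 f -> C0 h -> (forall x, h x = k * f x) ->
  C0_op h u = k *: C0_op f u.
Proof.
move=> Cf Ch hf.
apply: (@eq_arbitrarily_close _ _ _ _ (`|k| * `|u| + `|k| * `|u|)).
  by rewrite !addr_ge0 ?mulr_ge0.
move=> e e0 _; have [f' Cf' ff'] := C0_Cc_approx Cf e0.
apply: (le_trans (dist3 _ _ (r (fun x => k * f' x) u) (r (fun x => k * f' x) u))).
rewrite subrr normr0 addr0 mulrDr; apply: lerD.
  have ke0 : 0 <= e * `|k| by rewrite mulr_ge0 // ltW.
  rewrite mulrA; apply: (C0_opP u Ch ke0 (CcZ k Cf')) => x.
  by rewrite hf -mulrBr normrM mulrC ler_wpM2r.
rewrite (Cc_opZ rP) // -scalerBr normrZ mulrCA ler_wpM2l //.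
exact: (C0_opP u Cf (ltW e0) Cf' ff').
Qed.

Lemma C0_opM f g h u : C0 f -> C0 g -> C0 h -> (forall x, h x = f x * g x) ->
  C0_op h u = C0_op f (C0_op g u).
Proof.
move=> Cf Cg Ch hfg.
have [M M0 fM] := C0_bounded Cf; have [N N0 gN] := C0_bounded Cg.
apply: (@eq_arbitrarily_close _ _ _ _ ((M + (N + 1)) * `|u| + (`|C0_op g u| + (M + 1) * `|u|))).
  by rewrite !addr_ge0 ?mulr_ge0 ?addr_ge0.
move=> e e0 e1; have [f' Cf' ff'] := C0_Cc_approx Cf e0.
have [g' Cg' gg'] := C0_Cc_approx Cg e0.
have f'M x : `|f' x| <= M + 1.
  rewrite -[f' x](subrK (f x)) addrC; apply: (le_trans (ler_normD _ _)).
  by apply: lerD; [exact: fM|rewrite distrC; exact: le_trans (ff' x) e1].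
have g'N x : `|g' x| <= N + 1.
  rewrite -[g' x](subrK (g x)) addrC; apply: (le_trans (ler_normD _ _)).
  by apply: lerD; [exact: gN|rewrite distrC; exact: le_trans (gg' x) e1].
have M10 : 0 <= M + 1 by rewrite addr_ge0.
have N10 : 0 <= N + 1 by rewrite addr_ge0.
pose z := r (fun x => f' x * g' x) u.
apply: (le_trans (dist3 _ _ z z)).
rewrite subrr normr0 addr0 mulrDr; apply: lerD.
  have k0 : 0 <= e * (M + (N + 1)) by rewrite mulr_ge0 ?addr_ge0 // ltW.
  rewrite mulrA; apply: (C0_opP u Ch k0 (CcM Cf' Cg')) => x.
  (* The first summand is at most M e by the bound on f, the second at most e (N + 1) by the bound
     on g'. *)
  have -> : h x - f' x * g' x = f x * (g x - g' x) + (f x - f' x) * g' x.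
    by rewrite hfg mulrBr mulrBl addrA subrK.
  apply: (le_trans (ler_normD _ _)); rewrite !normrM mulrDr; apply: lerD.
    by rewrite mulrC; apply: ler_pM.
  by apply: ler_pM.
rewrite /z (Cc_opM rP) //.
apply: (le_trans (dist3 _ _ (r f' (C0_op g u)) (r f' (C0_op g u)))).
rewrite subrr normr0 addr0 mulrDr; apply: lerD.
  exact: (C0_opP _ Cf (ltW e0) Cf' ff').
rewrite -(Cc_op_vB rP).
apply: (le_trans (Cc_op_bound rP _ Cf' M10 f'M)).
rewrite mulrCA ler_wpM2l // distrC; exact: (C0_opP u Cg (ltW e0) Cg' gg').
Qed.

Lemma C0_opJ f h u v : C0 f -> C0 h -> (forall x, h x = (f x)^*) ->
  hdot (C0_op h u) v = hdot u (C0_op f v).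
Proof.
move=> Cf Ch hf; apply/eqP; rewrite -subr_eq0 -normr_le0.
apply/ler_addgt0Pr => d d0; rewrite add0r.
pose M := `|u| * `|v|.
have M0 : 0 <= M by rewrite mulr_ge0.
(* Two differences will each contribute at most [e * M]; the summand 1 covers the case where M is
   0. *)
have M20 : 0 < M * 2 + 1 by rewrite ltr_wpDl ?mulr_ge0.
pose e := d / (M * 2 + 1).
have e0 : 0 < e by rewrite divr_gt0.
have [f' Cf' ff'] := C0_Cc_approx Cf e0.
have h1 : `|C0_op h u - r (fun x => (f' x)^*) u| <= e * `|u|.
  apply: (C0_opP u Ch (ltW e0) (Cc_conj Cf')) => x.
  by rewrite hf -rmorphB norm_conjC.
have h2 : `|C0_op f v - r f' v| <= e * `|v| by exact: (C0_opP v Cf (ltW e0) Cf' ff').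
have -> : hdot (C0_op h u) v - hdot u (C0_op f v) =
    hdot (C0_op h u - r (fun x => (f' x)^*) u) v - hdot u (C0_op f v - r f' v).
  by rewrite linearBl linearBr /= (Cc_opJ rP) // opprB addrA subrK.
apply: (@le_trans _ _ (e * (M * 2))); last first.
  by rewrite /e mulrAC ler_pdivrMr // ler_wpM2l ?(ltW d0) ?lerDl.
rewrite mulrDr mulr1 mulrDr.
apply: (le_trans (ler_normB _ _)); apply: lerD.
  apply: (le_trans (hdot_CauchySchwarz _ _)).
  by rewrite /M mulrA ler_wpM2r.
apply: (le_trans (hdot_CauchySchwarz _ _)).
by rewrite /M mulrCA ler_wpM2l.
Qed.

Lemma C0_extension_exists : exists rho : @C0 R X -> boundedOp K,
  star_rep (fun f g (x : X) => f x * g x) (fun f (x : X) => (f x)^*) rho /\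
  forall f : @C0 R X, Cc (val f) -> forall u, rho f u = r (val f) u.
Proof.
have C0f (f : @C0 R X) : C0 (val f) by exact: set_valP.
exists (fun f : @C0 R X => BoundedOp (C0_op_linear (C0f f)) (C0_op_bounded (C0f f))).
split; last by move=> f Cf u /=; exact: C0_op_Cc.
split=> /=.
- by move=> f g h hfg u; apply: C0_opD hfg; exact: C0f.
- by move=> k f h hf u; apply: C0_opZ hf; exact: C0f.
- by move=> f g h hfg u; apply: C0_opM; [exact: C0f..|move=> x; rewrite hfg].
- by move=> f h hf u v; apply: C0_opJ; [exact: C0f..|move=> x; rewrite hf].
Qed.

End Extension.

(** * Inverse semigroups and twists *)

Section InverseSemigroupTheory.
Context {S : invSemigroupType}.
Implicit Types s t e f : S.
Local Open Scope group_scope.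

Lemma istarK s : s^*^* = s.
Proof. by apply/esym/istar_unique; [exact: mulsK|exact: mulKs]. Qed.

Lemma idem_istar e : idem e -> e^* = e.
Proof. by move=> ee; apply/esym/istar_unique; rewrite !ee. Qed.

(** With x the inverse of ef, the element f x e is also an inverse of ef. Uniqueness gives x = f x
    e, which makes x idempotent, hence its own inverse, and so equal to ef. *)
Lemma idem_mul e f : idem e -> idem f -> idem (e * f).
Proof.
move=> ee ff; set x := (e * f)^*.
have H1 : e * f * x * e * f = e * f by rewrite -[RHS](mulKs (e * f)) !mulgA.
have H2 : x * e * f * x = x by rewrite -[RHS](mulsK (e * f)) !mulgA.
have xx : x = f * x * e.
  apply/esym/istar_unique; rewrite !mulgA -(mulgA _ e e) ee -(mulgA _ f f) ff //.
  by rewrite -[X in _ = f * X * e]H2 !mulgA.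
have ix : idem x.
  by rewrite /idem {1 2}xx [RHS]xx -[X in _ = f * X * e]H2 !mulgA.
by have := istarK (e * f); rewrite -/x idem_istar // => <-.
Qed.

(** Both products are idempotent and fe is an inverse of ef, while an idempotent is its own
    inverse. *)
Lemma idem_mulC e f : idem e -> idem f -> e * f = f * e.
Proof.
move=> ee ff; have ef := idem_mul ee ff; have fe := idem_mul ff ee.
rewrite -[LHS]idem_istar //; apply/esym/istar_unique.
  by rewrite !mulgA -(mulgA _ f f) ff -(mulgA _ e e) ee -mulgA.
by rewrite !mulgA -(mulgA _ e e) ee -(mulgA _ f f) ff -mulgA.
Qed.

Lemma idem_dom s : idem (s^* * s). Proof. by rewrite /idem mulgA mulsK. Qed.

Lemma idem_ran s : idem (s * s^*). Proof. by rewrite /idem mulgA mulKs. Qed.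

Lemma istarM s t : (s * t)^* = t^* * s^*.
Proof.
apply/esym/istar_unique.
  have -> : s * t * (t^* * s^*) * (s * t) = s * ((t * t^*) * (s^* * s)) * t by rewrite !mulgA.
  by rewrite (idem_mulC (idem_ran t) (idem_dom s)) !mulgA mulKs -!(mulgA s) mulKs.
have -> : t^* * s^* * (s * t) * (t^* * s^*) = t^* * ((s^* * s) * (t * t^*)) * s^*.
  by rewrite !mulgA.
by rewrite (idem_mulC (idem_dom s) (idem_ran t)) !mulgA mulsK -!(mulgA t^*) mulsK.
Qed.

End InverseSemigroupTheory.

Lemma istar_morph (S S' : invSemigroupType) (f : {multiplicative S -> S'}) s :
  f (s^*)%g = ((f s)^*)%g.
Proof. by apply: istar_unique; rewrite -!gmulfM ?mulKs ?mulsK. Qed.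

(** * The action of S on X *)

Section Twists.
Context {R : realType} {X : booleanSpaceType} {G S : invSemigroupType}
  {D : dualSpace X G}.
Variable tw : twist R S D.
Local Notation T := (circleFun R X).
Local Notation C := (Cplx R).
Local Notation p := (tw_p tw).
Local Notation i := (tw_i tw).
Local Notation dom := (bis_dom D p).
Local Notation phi := (dual_map D p).
Implicit Types (s t : S) (x y : X) (h k c : T).

Lemma dom_copen s : copen (dom s).
Proof.
have ds : idem (p (s^* * s)%g) by rewrite /idem -gmulfM idem_dom.
by split; [exact: dual_compact ds|exact: dual_open ds].
Qed.

Definition cind (U : set X) (Uco : copen U) : T := circle_indicator Uco.1 Uco.2.

Lemma domP s h : (i h = s^* * s)%g -> forall x, dom s x <-> h x != 0.
Proof.
move=> ih x; have hh : idem h.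
  by apply: (tw_i_inj (t := tw)); rewrite gmulfM ih idem_dom.
by rewrite /bis_dom -ih (tw_idem_supp tw hh).
Qed.

(** The domain idempotent lies in T(X), and an idempotent function is 1 wherever it is nonzero.
    Domain idempotents can thus be handled as indicator functions. *)
Lemma i_cind_dom s : i (cind (dom_copen s)) = (s^* * s)%g.
Proof.
have [h ih] : exists h, i h = (s^* * s)%g.
  by apply/(tw_exact tw); rewrite /idem -gmulfM idem_dom.
rewrite -ih; congr (i _); apply: circleP => x.
have hh : idem h by apply: (tw_i_inj (t := tw)); rewrite gmulfM ih idem_dom.
rewrite -[LHS]/(ind (dom s) x); have [sx|sx] := pselect (dom s x).
  rewrite ind1 //; have hx := (domP ih x).1 sx.
  by apply: (mulfI hx); rewrite mulr1 -[RHS]circle_mulE hh.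
rewrite ind0 //; apply/esym/eqP; apply: contra_notT sx; exact: (domP ih x).2.
Qed.

Lemma bis_ranE s : bis_ran D p s = dom (s^*)%g.
Proof. by rewrite /bis_dom istarK. Qed.

(** Conjugating the indicator of [dom s] by s gives the idempotent of the range, whose value at
    [phi s x] is 1 by [tw_conj]. *)
Lemma phi_dom s x : dom s x -> dom (s^*)%g (phi s x).
Proof.
move=> sx; have [k [ik _ kphi]] := tw_conj tw s (cind (dom_copen s)).
have := kphi x sx; rewrite -[RHS]/(ind (dom s) x) ind1 // => k1.
have ik' : (i k = s^*^* * s^*)%g.
  by rewrite -ik i_cind_dom istarK mulgA mulKs.
by apply/(domP ik'); rewrite k1 oner_eq0.
Qed.

(** The indicator of a compact open set around x that misses y tells them apart. Equalities between
    values of [phi] are proved through this. *)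
Lemma T_separates x y : (forall h : T, h x = h y) -> x = y.
Proof.
move=> hxy; apply/eqP; apply: contraT => xy.
have := @boolean_hausdorff X; rewrite open_hausdorff => /(_ x y xy).
move=> [[U V] /= [/[!inE] Ux Vy] [oU oV UV]].
have [W [Wco Wx WU]] := boolean_base (open_nbhs_nbhs (conj oU Ux)).
have := hxy (cind Wco); rewrite -[LHS]/(ind W x) -[RHS]/(ind W y) ind1 // ind0.
  by move/eqP; rewrite oner_eq0.
by move=> /WU Uy; rewrite -[False]/(set0 y) -UV.
Qed.

Lemma phi_inj s x y : dom s x -> dom s y -> phi s x = phi s y -> x = y.
Proof.
move=> sx sy xy; apply: T_separates => h; have [k [_ _ kphi]] := tw_conj tw s h.
by rewrite -!kphi // xy.
Qed.

Lemma iC h k : (i h * i k = i k * i h)%g.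
Proof. by rewrite -!gmulfM circle_mulC. Qed.

(** [tw_conj] at the inverse of s would describe k along the map of that inverse, not yet known to
    invert [phi s]. Conjugating k back by s gives c cut to the range of s, and [tw_conj] at s then
    yields the values of k. *)
Lemma pull_i s c : exists k, [/\ (s^* * i c * s = i k)%g,
  forall x, dom s x -> k x = c (phi s x) & forall x, ~ dom s x -> k x = 0].
Proof.
have [k [ik ksupp _]] := tw_conj tw (s^*)%g c; rewrite istarK in ik.
exists k; split=> //; last first.
  move=> x sx; apply/eqP; apply: contra_notT sx => kx.
  by have := ksupp x kx; rewrite bis_ranE istarK.
move=> x sx; have [k' [ik' _ k'phi]] := tw_conj tw s k.
have es : i (cind (dom_copen s^*)%g) = (s * s^*)%g by rewrite i_cind_dom istarK.
have E : k' = (c * cind (dom_copen (s^*)%g))%g.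
  apply: (tw_i_inj (t := tw)); rewrite -ik' -ik gmulfM.
  have -> : (s * (s^* * i c * s) * s^* = s * s^* * i c * (s * s^*))%g by rewrite !mulgA.
  by rewrite -es iC -mulgA es idem_ran.
rewrite -(k'phi x sx) E circle_mulE -[X in _ * X]/(ind _ _) ind1 ?mulr1 //.
exact: phi_dom.
Qed.

(** Write s as s s^* s and let c commute with the idempotent s s^*: the result is s times the
    conjugate k of [pull_i]. *)
Lemma i_comm_strict s c : exists k, [/\ (i c * s = s * i k)%g,
  forall x, dom s x -> k x = c (phi s x) & forall x, ~ dom s x -> k x = 0].
Proof.
have [k [ik kphi k0]] := pull_i s c; exists k; split=> //.
rewrite -ik !mulgA.
have es : i (cind (dom_copen s^*)%g) = (s * s^*)%g by rewrite i_cind_dom istarK.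
by rewrite -es iC es -mulgA mulKs.
Qed.

Lemma i_comm s c : exists k, (i c * s = s * i k)%g /\
  forall x, dom s x -> k x = c (phi s x).
Proof. by have [k [ik kphi _]] := i_comm_strict s c; exists k. Qed.

Lemma phiK s x : dom s x -> phi (s^*)%g (phi s x) = x.
Proof.
move=> sx; apply: T_separates => h.
have [k [ik kphi _]] := pull_i (s^*)%g h.
have [k' [ik' _ k'phi]] := tw_conj tw s h.
have kk' : k = k' by apply: (tw_i_inj (t := tw)); rewrite -ik -ik' istarK.
by rewrite -kphi ?kk' ?k'phi //; exact: phi_dom.
Qed.

(** The domain idempotent of st is the conjugate by t of the indicator of [dom s], which [pull_i]
    evaluates. *)
Lemma domM s t x : dom (s * t)%g x <-> dom t x /\ dom s (phi t x).
Proof.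
have [k [ik kphi k0]] := pull_i t (cind (dom_copen s)).
have E : (i k = (s * t)^* * (s * t))%g.
  by rewrite -ik i_cind_dom istarM !mulgA.
rewrite (domP E x); split.
  move=> kx; have tx : dom t x by apply: contrapT => /k0 kx0; rewrite kx0 eqxx in kx.
  split=> //; move: kx; rewrite kphi // -[cind _ _]/(ind _ _).
  by apply: contra_neqP => sx; rewrite ind0.
by move=> [tx sx]; rewrite kphi // -[cind _ _]/(ind _ _) ind1 // oner_eq0.
Qed.

Lemma phiM s t x : dom (s * t)%g x -> phi (s * t)%g x = phi s (phi t x).
Proof.
move=> stx; have [tx sx] := (domM s t x).1 stx; apply: T_separates => h.
have [k [ik kphi _]] := pull_i (s * t)%g h.
have [k1 [ik1 k1phi _]] := pull_i s h.
have [k2 [ik2 k2phi _]] := pull_i t k1.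
have kk2 : k = k2.
  by apply: (tw_i_inj (t := tw)); rewrite -ik -ik2 -ik1 istarM !mulgA.
by rewrite -kphi // kk2 k2phi // k1phi.
Qed.

Lemma dom_i h x : dom (i h) x <-> h x != 0.
Proof.
have E : (i (h^* * h) = (i h)^* * i h)%g by rewrite gmulfM istar_morph.
rewrite (domP E x) circle_mulE; split.
  by apply: contra_neq => ->; rewrite mulr0.
by move=> hx; rewrite /= mulf_eq0 conjC_eq0 negb_or hx.
Qed.

Lemma phi_i h x : h x != 0 -> phi (i h) x = x.
Proof.
move=> hx; apply: T_separates => c; have [k [ik kphi _]] := pull_i (i h) c.
rewrite -kphi; last exact/dom_i.
have -> : k = (h^* * c * h)%g.
  by apply: (tw_i_inj (t := tw)); rewrite -ik !gmulfM istar_morph.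
by rewrite !circle_mulE /= mulrAC [_^* * _]mulrC -normCK (circle_norm1 hx) expr1n mul1r.
Qed.

Lemma i_zero : i circle_zero = izero.
Proof.
have [h ih] : exists h, i h = izero.
  by apply/(tw_exact tw); rewrite /idem -gmulfM mul0s.
rewrite -ih; congr (i _); apply: (tw_i_inj (t := tw)).
have <- : (h * circle_zero)%g = circle_zero by apply: circleP => x; rewrite circle_mulE circle_zeroE mulr0.
by rewrite gmulfM ih mul0s.
Qed.

Lemma dom_zero x : ~ dom izero x.
Proof. by rewrite -i_zero dom_i circle_zeroE eqxx. Qed.

Lemma dom_istar_phi s x : dom (s^*)%g x -> dom s (phi (s^*)%g x).
Proof. by move=> /phi_dom; rewrite istarK. Qed.

(** The preimage of a compact open V is the support of the pullback of its indicator, an element of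
    T(X), so it is open. *)
Lemma phi_continuous s x U : dom s x -> nbhs (phi s x) U ->
  nbhs x [set y | dom s y /\ U (phi s y)].
Proof.
move=> sx Ux; have [V [Vco Vx VU]] := boolean_base Ux.
have [k [_ kphi k0]] := pull_i s (cind Vco).
have kx : k x != 0 by rewrite kphi // -[cind Vco _]/(ind V _) ind1 // oner_eq0.
have := open_nbhs_nbhs (conj (dom_copen (i k)).2 ((dom_i k x).2 kx)).
apply: filterS => y /dom_i ky.
have sy : dom s y by apply: contrapT => /k0 ky0; rewrite ky0 eqxx in ky.
split=> //; apply: VU; move: ky; rewrite kphi // -[cind Vco _]/(ind V _) => Vy.
by apply: contrapT => nVy; rewrite ind0 // eqxx in Vy.
Qed.

(** Extending by 0 preserves continuity because [dom s] is clopen. *)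
Definition pull s (b : X -> C) x : C := if pselect (dom s x) then b (phi s x) else 0.

Lemma pullE s b x : dom s x -> pull s b x = b (phi s x).
Proof. by rewrite /pull; case: pselect. Qed.

Lemma pull0 s b x : ~ dom s x -> pull s b x = 0.
Proof. by rewrite /pull; case: pselect. Qed.

Lemma Cc_pull s b : continuous b -> Cc (pull s b).
Proof.
move=> cb; apply/CcP; split; last first.
  by exists (dom s); [exact: dom_copen|move=> x; exact: pull0].
move=> x; apply/cvgrPdist_lt => e e0.
have [sx|sx] := pselect (dom s x).
  have /cvgrPdist_lt/(_ e e0) := cb (phi s x).
  move=> /(phi_continuous sx); apply: filterS => y [sy].
  by rewrite (pullE _ sx) (pullE _ sy).
have nsx : open_nbhs x (~` dom s).
  by split=> //; apply: closed_openC; exact: copen_closed (dom_copen s).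
apply: filterS (open_nbhs_nbhs nsx) => y sy.
by rewrite !pull0 // subrr normr0.
Qed.

Lemma i_comm_pull s c : exists k : T, (i c * s = s * i k)%g /\ circle_fun k = pull s c.
Proof.
have [k [ik kphi k0]] := i_comm_strict s c; exists k; split=> //.
apply/funext => x; have [sx|sx] := pselect (dom s x); first by rewrite pullE ?kphi.
by rewrite pull0 ?k0.
Qed.

End Twists.

(** * Germs and the functions Delta *)

Section GermCalculus.
Context {R : realType} {X : booleanSpaceType} {G S : invSemigroupType}
  {D : dualSpace X G}.
Variable tw : twist R S D.
Local Notation T := (circleFun R X).
Local Notation C := (Cplx R).
Local Notation p := (tw_p tw).
Local Notation i := (tw_i tw).
Local Notation dom := (bis_dom D p).
Local Notation phi := (dual_map D p).
Local Notation is_germ := (@is_germ R X G S D tw).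
Implicit Types (s t v w : S) (x y : X) (h k a c : T) (sigma tau rho : Sigma tw).

Lemma T_inv h x : h x != 0 -> h x * (h x)^* = 1.
Proof. by move=> hx; rewrite -normCK (circle_norm1 hx) expr1n. Qed.

Lemma T_conj_neq0 h x : h x != 0 -> (h^*)%g x != 0.
Proof. by move=> hx; rewrite /= conjC_eq0. Qed.

Lemma T_mul_neq0 h k x : h x != 0 -> k x != 0 -> (h * k)%g x != 0.
Proof. by move=> hx kx; rewrite circle_mulE mulf_neq0. Qed.

Lemma dom_mul_i s a x : dom s x -> a x != 0 -> dom (s * i a)%g x.
Proof. by move=> sx ax; rewrite domM dom_i phi_i. Qed.

Lemma phi_mul_i s a x : dom s x -> a x != 0 -> phi (s * i a)%g x = phi s x.
Proof. by move=> sx ax; rewrite phiM ?phi_i //; exact: dom_mul_i. Qed.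

Lemma phi_eq s t a c x : dom s x -> dom t x -> a x != 0 -> c x != 0 ->
  (t * i a = s * i c)%g -> phi t x = phi s x.
Proof. by move=> sx tx ax cx E; rewrite -(phi_mul_i tx ax) E phi_mul_i. Qed.

Lemma is_germ_ex sigma : exists s x, is_germ sigma s x.
Proof.
exists (val (repr sigma)).1, (val (repr sigma)).2, (repr sigma); last by rewrite reprK.
by case: (val _).
Qed.

Lemma is_germ_intro s x : dom s x -> exists sigma, is_germ sigma s x.
Proof.
move=> sx; have P : `[< dom (s, x).1 (s, x).2 >] by apply/asboolP.
by exists (\pi_(Sigma tw) (exist _ (s, x) P : germ_pair tw)), (exist _ (s, x) P).
Qed.

Lemma is_germ_eq sigma tau s t x a c : is_germ sigma s x -> is_germ tau t x ->
  a x = 1 -> c x = 1 -> (s * i a = t * i c)%g -> sigma = tau.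
Proof.
move=> [u ux ->] [w wx ->] ax cx E; apply/eqmodP; apply/asboolP.
by rewrite ux wx; split=> //; exists a, c; rewrite ax cx.
Qed.

Lemma is_germ_sim sigma s t x y : is_germ sigma s x -> is_germ sigma t y ->
  x = y /\ exists a c, [/\ a x = 1, c x = 1 & (s * i a = t * i c)%g].
Proof.
move=> [u ux ->] [w wx E]; have /eqmodP/asboolP := E.
by rewrite ux wx.
Qed.

Lemma is_germ_trans sigma s t x a c : is_germ sigma s x -> dom t x ->
  a x = 1 -> c x = 1 -> (s * i a = t * i c)%g -> is_germ sigma t x.
Proof.
move=> sx tx ax cx E; have [tau taux] := is_germ_intro tx.
by rewrite (is_germ_eq sx taux ax cx E).
Qed.

Lemma germ_ranE sigma s x : is_germ sigma s x -> germ_ran sigma = phi s x.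
Proof.
move=> sx; have gx : is_germ sigma (val (repr sigma)).1 (val (repr sigma)).2.
  by exists (repr sigma); [case: (val _)|rewrite reprK].
have [<- [a [c [ax cx E]]]] := is_germ_sim gx sx.
rewrite /germ_ran; have [xx _] := is_germ_sim gx sx.
have neq h : h (val (repr sigma)).2 = 1 -> h (val (repr sigma)).2 != 0.
  by move=> ->; rewrite oner_eq0.
apply: (phi_eq _ _ (neq _ ax) (neq _ cx) E); last exact: is_germ_in_dom gx.
by rewrite xx; exact: is_germ_in_dom sx.
Qed.

Lemma is_germ_mul sigma tau s t x : is_germ tau t x -> is_germ sigma s (phi t x) ->
  is_germ (germ_mul sigma tau) (s * t)%g x.
Proof.
move=> tx sx; have dt := is_germ_in_dom tx; have ds := is_germ_in_dom sx.
have st : dom (s * t)%g x by apply/domM.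
rewrite /germ_mul; case: xgetP => [rho _ [s' [t' [x' [t'x s'x rx]]]]|nex]; last first.
  have [rho rx] := is_germ_intro st; case: (nex rho).
  by exists s, t, x.
have [xx [a [c [ax cx E]]]] := is_germ_sim tx t'x; rewrite -{}xx in t'x s'x rx *.
have [yy [a' [c' [ax' cx' E']]]] := is_germ_sim sx s'x.
(* The factor a' has to cross t, and c' has to cross t'. Crossing composes them with the maps of t
   and t', so their values at x remain 1. *)
have [k [Ek kx]] := i_comm tw t a'; have [k' [Ek' kx']] := i_comm tw t' c'.
apply: (@is_germ_trans rho (s' * t')%g (s * t)%g x (k' * c)%g (k * a)%g) => //.
- rewrite circle_mulE kx' ?cx ?mulr1 -?yy //; exact: is_germ_in_dom t'x.
- by rewrite circle_mulE kx // ax mulr1.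
- rewrite !gmulfM !mulgA -(mulgA s') -Ek' -(mulgA s t) -Ek !mulgA -E' -!mulgA.
  by rewrite E.
Qed.

Lemma is_germ_inv sigma s x : is_germ sigma s x ->
  is_germ (germ_inv sigma) (s^*)%g (phi s x).
Proof.
move=> sx; have ds := is_germ_in_dom sx.
rewrite /germ_inv; case: xgetP => [rho _ [t [y [ty rx]]]|nex]; last first.
  have [rho rx] := is_germ_intro (phi_dom ds); case: (nex rho).
  by exists s, x.
have [xx [a [c [ax cx E]]]] := is_germ_sim sx ty; rewrite -{}xx in ty rx.
have dt := is_germ_in_dom ty.
have a0 : a x != 0 by rewrite ax oner_eq0.
have c0 : c x != 0 by rewrite cx oner_eq0.
have st : phi s x = phi t x by exact: phi_eq E.
(* The star turns the right factors a and c into left factors; crossing brings them back to the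
   right. *)
have [k [Ek kx]] := i_comm tw (s^*)%g (a^*)%g.
have [k' [Ek' kx']] := i_comm tw (t^*)%g (c^*)%g.
rewrite st; apply: (@is_germ_trans rho (t^*)%g (s^*)%g (phi t x) k' k) => //.
- by rewrite -st; exact: phi_dom.
- by rewrite kx' ?phiK //= ?cx ?conjC1 //; exact: phi_dom.
- by rewrite -st kx ?phiK //= ?ax ?conjC1 //; exact: phi_dom.
- by rewrite -Ek -Ek' !istar_morph -!istarM E.
Qed.

Lemma T_const_spec (U : set X) (theta : C) : copen U -> `|theta| = 1 ->
  exists h : T, forall x, h x = theta * ind U x.
Proof.
move=> Uco th1; have th0 : theta != 0 by rewrite -normr_eq0 th1 oner_eq0.
have ct : continuous (fun x => theta * ind U x).
  by have [] := CcZ theta (Cc_ind (R := R) Uco).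
have E : [set x | theta * ind U x != 0] = U.
  by rewrite -[RHS](@indicator_supp R X U); apply/seteqP; split=> x /=;
    rewrite mulf_eq0 (negPf th0).
have cs : compact [set x | theta * ind U x != 0] by rewrite E; case: Uco.
have n1 x : theta * ind U x != 0 -> `|theta * ind U x| = 1.
  rewrite normrM th1 mul1r mulf_eq0 (negPf th0); exact: indicator_norm1.
by exists (CircleFun ct cs n1).
Qed.

Lemma is_germ_circle sigma s x c : is_germ sigma s x -> c x != 0 ->
  is_germ (germ_circle sigma (c x)) (s * i c)%g x.
Proof.
move=> sx cx; have ds := is_germ_in_dom sx.
have dsc : dom (s * i c)%g x by exact: dom_mul_i.
rewrite /germ_circle; case: xgetP => [rho _ [s' [y [c' [s'y c'y rx]]]]|nex]; last first.
  have [rho rx] := is_germ_intro dsc; case: (nex rho).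
  by exists s, x, c.
have [xx [a [b [ax bx E]]]] := is_germ_sim sx s'y; rewrite -{}xx in s'y c'y rx.
(* Both sides become [s' * i b = s * i a] followed by the image of [c' * c * c^*]. The added factors
   are 1 at x because [c' x = c x]. *)
apply: (@is_germ_trans rho (s' * i c')%g (s * i c)%g x (b * (c * c^*))%g (a * (c' * c^*))%g) => //.
- by rewrite !circle_mulE bx mul1r; exact: T_inv.
- by rewrite !circle_mulE ax mul1r c'y; exact: T_inv.
- have e1 : (c' * (b * (c * c^*)) = b * (c' * (c * c^*)))%g.
    by rewrite !mulgA (circle_mulC c' b).
  have e2 : (c * (a * (c' * c^*)) = a * (c' * (c * c^*)))%g.
    by rewrite !mulgA (circle_mulC c a) -(mulgA a c c') (circle_mulC c c') !mulgA.
  rewrite -!mulgA -(gmulfM (s:=i) c') e1 -(gmulfM (s:=i) c) e2.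
  by rewrite (gmulfM (s:=i) b) (gmulfM (s:=i) a) !mulgA E.
Qed.

(* On the germ [t, x] the function Delta_S(s) takes the value z. *)
Definition germ_coef s t x (z : C) :=
  [/\ dom s x, dom t x & exists a c, [/\ a x != 0, c x != 0,
    (t * i a = s * i c)%g & z = a x * (c x)^*]].

(** The two equations give s c a' = s c' a. Left multiplication by s^* only cancels s up to the
    indicator of [dom s], which is 1 at x. *)
Lemma germ_coef_fun s t x z z' : germ_coef s t x z -> germ_coef s t x z' -> z = z'.
Proof.
move=> [sx tx [a [c [ax cx E ->]]]] [_ _ [a' [c' [ax' cx' E' ->]]]].
have E2 : (s * i (c * a') = s * i (c' * a))%g.
  by rewrite (gmulfM (s:=i) c a') (gmulfM (s:=i) c' a) !mulgA -E -E' -!mulgA iC.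
have : (cind (dom_copen tw s) * (c * a') = cind (dom_copen tw s) * (c' * a))%g.
  apply: (tw_i_inj (t := tw)).
  by rewrite !(gmulfM (s:=i) (cind (dom_copen tw s))) i_cind_dom -!mulgA E2.
move=> /(congr1 (fun h : T => h x)); rewrite !circle_mulE.
rewrite -[cind _ x]/(ind (dom s) x) ind1 // !mul1r => H.
apply: (mulIf (mulf_neq0 cx cx')).
transitivity ((c x * (c x)^*) * (c' x * a x)); first by ring.
transitivity ((c' x * (c' x)^*) * (c x * a' x)); last by ring.
by rewrite !T_inv // H.
Qed.

Lemma germ_coef_neq0 s t x z : germ_coef s t x z -> z != 0.
Proof. by move=> [_ _ [a [c [ax cx _ ->]]]]; rewrite mulf_neq0 ?conjC_eq0. Qed.

Lemma germ_coef_phi s t x z : germ_coef s t x z -> phi t x = phi s x.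
Proof. by move=> [sx tx [a [c [ax cx E _]]]]; exact: phi_eq E. Qed.

Local Notation Dl s := (Delta (@bisection R X G S D tw s)).

(** The equation t a = s c says that [t, x] is [s, x] multiplied by the conjugate of a(x) times
    c(x); [Delta] takes the conjugate of this phase. *)
Lemma Delta_coef sigma s t x z : is_germ sigma t x -> germ_coef s t x z -> Dl s sigma = z.
Proof.
move=> tx zP; rewrite /Delta; case: xgetP => [z' _|nex].
  move=> [theta [tau [th1 [y sy] Esigma ->]]].
  (* The constant theta on [dom s] is an element of T(X), so the circle action becomes right
     multiplication by it in S. *)
  have [c0 c0P] := T_const_spec (dom_copen tw s) th1.
  have c0y : c0 y = theta by rewrite c0P ind1 ?mulr1 //; exact: is_germ_in_dom sy.
  have th0 : theta != 0 by rewrite -normr_eq0 th1 oner_eq0.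
  have := is_germ_circle (c := c0) sy; rewrite c0y -Esigma => /(_ th0) sy'.
  have [xy [a [c [ax cx E]]]] := is_germ_sim tx sy'; rewrite -{}xy in c0y sy sy'.
  apply: (germ_coef_fun _ zP); split.
  - exact: is_germ_in_dom sy.
  - exact: is_germ_in_dom tx.
  - exists a, (c0 * c)%g; split.
    + by rewrite ax oner_eq0.
    + by rewrite T_mul_neq0 // ?c0y // cx oner_eq0.
    + by rewrite E gmulfM mulgA.
    + by rewrite circle_mulE ax cx c0y mulr1 mul1r.
have [sx _ [a [c [ax cx E zE]]]] := zP.
have [tau taux] := is_germ_intro sx.
case: (nex z); exists ((a^* * c)%g x), tau; split.
- by apply: circle_norm1; apply: T_mul_neq0 => //; exact: T_conj_neq0.
- by exists x.
- have acx : (a^* * c)%g x != 0 by apply: T_mul_neq0 => //; exact: T_conj_neq0.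
  have scx := is_germ_circle taux acx.
  apply: (@is_germ_eq _ _ _ _ _ (a * a^* * (a * a^*))%g (a * a^*)%g tx scx).
  + by rewrite !circle_mulE [X in X * X]T_inv // mulr1.
  + by rewrite circle_mulE; exact: T_inv.
  + rewrite -(mulgA a) (gmulfM (s:=i) a) (mulgA t) E -!mulgA -!gmulfM; congr (_ * i _)%g.
    by rewrite !mulgA (circle_mulC c).
- by rewrite circle_mulE rmorphM /= conjCK zE.
Qed.

Lemma Delta_no_coef sigma s t x : is_germ sigma t x -> (forall z, ~ germ_coef s t x z) ->
  Dl s sigma = 0.
Proof.
move=> tx noz; rewrite /Delta; case: xgetP => // z' _ [theta [tau [th1 [y sy] Esigma _]]].
have [c0 c0P] := T_const_spec (dom_copen tw s) th1.
have c0y : c0 y = theta by rewrite c0P ind1 ?mulr1 //; exact: is_germ_in_dom sy.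
have th0 : theta != 0 by rewrite -normr_eq0 th1 oner_eq0.
have := is_germ_circle (c := c0) sy; rewrite c0y -Esigma => /(_ th0) sy'.
have [xy [a [c [ax cx E]]]] := is_germ_sim tx sy'; rewrite -{}xy in c0y sy sy'.
case: (noz (a x * ((c0 * c)%g x)^*)); split.
- exact: is_germ_in_dom sy.
- exact: is_germ_in_dom tx.
- exists a, (c0 * c)%g; split=> //.
  + by rewrite ax oner_eq0.
  + by rewrite T_mul_neq0 // ?c0y // cx oner_eq0.
  + by rewrite E gmulfM mulgA.
Qed.

Lemma Delta_neq0 sigma s t x : is_germ sigma t x -> Dl s sigma != 0 ->
  germ_coef s t x (Dl s sigma).
Proof.
move=> tx nz; have [[z zP]|noz] := pselect (exists z, germ_coef s t x z).
  by rewrite (Delta_coef tx zP).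
by rewrite (Delta_no_coef tx) ?eqxx // in nz => z zP; apply: noz; exists z.
Qed.

Lemma Delta_mul_i s h sigma : Dl (s * i h)%g sigma = h (germ_dom sigma) * Dl s sigma.
Proof.
have [t [x tx]] := is_germ_ex sigma; rewrite (is_germ_dom tx).
have [hx|hx] := eqVneq (h x) 0.
  rewrite hx mul0r (Delta_no_coef tx) // => z [/domM[/dom_i]]; by rewrite hx eqxx.
have fwd z : germ_coef (s * i h)%g t x z -> germ_coef s t x (z * (h x)^*).
  move=> [/domM[_ sx] dt [a [c [ax cx E ->]]]]; rewrite phi_i // in sx; split=> //.
  exists a, (h * c)%g; split=> //; first exact: T_mul_neq0.
    by rewrite E gmulfM mulgA.
  by rewrite circle_mulE rmorphM /= mulrAC -mulrA.
have [[z zP]|noz] := pselect (exists z, germ_coef (s * i h)%g t x z).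
  by rewrite (Delta_coef tx zP) (Delta_coef tx (fwd z zP)) mulrCA T_inv // mulr1.
rewrite (Delta_no_coef tx); last by move=> z zP; apply: noz; exists z.
rewrite (Delta_no_coef tx) ?mulr0 // => z [sx dt [a [c [ax cx E _]]]].
apply: noz; exists ((a * (h * h^*))%g x * ((h^* * c)%g x)^*).
split=> //; first exact: dom_mul_i.
exists (a * (h * h^*))%g, (h^* * c)%g; split=> //.
- by apply: T_mul_neq0 => //; apply: T_mul_neq0 => //; exact: T_conj_neq0.
- by apply: T_mul_neq0 => //; exact: T_conj_neq0.
- rewrite gmulfM mulgA E -!mulgA -!gmulfM; congr (_ * i _)%g.
  by rewrite (circle_mulC c) mulgA.
Qed.

Lemma germ_coef_istar s t x z : dom t x ->
  germ_coef s (t^*)%g (phi t x) z -> germ_coef (s^*)%g t x (z^*) /\ phi (s^*)%g x = phi t x.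
Proof.
move=> tx zP; have Ephi := germ_coef_phi zP.
have [sy ty [a [c [ay cy E zE]]]] := zP.
rewrite phiK // in Ephi.
have sx : dom (s^*)%g x by rewrite Ephi; exact: phi_dom.
have Ey : phi (s^*)%g x = phi t x by rewrite {1}Ephi phiK.
split=> //; split=> //.
have [k [Ek kx]] := i_comm tw t (a^*)%g.
have [k' [Ek' kx']] := i_comm tw (s^*)%g (c^*)%g.
exists k, k'; split.
- by rewrite kx //; exact: T_conj_neq0.
- by rewrite kx' // Ey; exact: T_conj_neq0.
- by rewrite -Ek -Ek' !istar_morph -{1}(istarK t) -!istarM E.
- by rewrite kx // kx' // Ey zE /= rmorphM /= conjCK.
Qed.

Definition mono s (b : X -> C) sigma : C := Dl s sigma * b (germ_dom sigma).

Lemma mono_star s b : germ_star tw (mono s b) =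
  mono (s^*)%g (pull tw (s^*)%g (fun x => (b x)^*)).
Proof.
apply/funext => sigma; have [t [x tx]] := is_germ_ex sigma.
have dt := is_germ_in_dom tx; have tinv := is_germ_inv tx.
rewrite /germ_star /mono (is_germ_dom tx) (is_germ_dom tinv).
have [[z zP]|noz] := pselect (exists z, germ_coef s (t^*)%g (phi t x) z).
  have [zP' Ey] := germ_coef_istar dt zP.
  rewrite (Delta_coef tinv zP) (Delta_coef tx zP') rmorphM /=.
  by rewrite pullE ?Ey //; case: zP'.
rewrite (Delta_no_coef tinv); last by move=> z zP; apply: noz; exists z.
rewrite mul0r conjC0 (Delta_no_coef tx) ?mul0r // => z zP; apply: noz; exists (z^*).
have dt' := phi_dom dt.
have zP' : germ_coef (s^*)%g (t^*^*)%g (phi (t^*)%g (phi t x)) z by rewrite phiK // istarK.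
by have [] := germ_coef_istar dt' zP'; rewrite istarK.
Qed.

End GermCalculus.

(** * Convolution of the spanning functions *)

Section Convolution.
Context {R : realType} {X : booleanSpaceType} {G S : invSemigroupType}
  {D : dualSpace X G}.
Variable tw : twist R S D.
Local Notation T := (circleFun R X).
Local Notation C := (Cplx R).
Local Notation p := (tw_p tw).
Local Notation i := (tw_i tw).
Local Notation dom := (bis_dom D p).
Local Notation phi := (dual_map D p).
Local Notation is_germ := (@is_germ R X G S D tw).
Local Notation Dl s := (Delta (@bisection R X G S D tw s)).
Local Notation mono := (mono (tw := tw)).
Local Notation germ_coef := (germ_coef tw).
Implicit Types (s t v w : S) (x y : X) (h k a c : T) (sigma tau rho : Sigma tw).

Definition Germ_elt (g : Germ tw) : S := (val (repr g)).1.
Definition Germ_dom (g : Germ tw) : X := (val (repr g)).2.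

Lemma Germ_liftP (g : Germ tw) : is_germ (Germ_lift g) (Germ_elt g) (Germ_dom g).
Proof. by exists (repr g) => //; rewrite /Germ_elt /Germ_dom; case: (val _). Qed.

Lemma Germ_ranE (g : Germ tw) : Germ_ran g = phi (Germ_elt g) (Germ_dom g).
Proof. by []. Qed.

(** A bisection meets each range fibre at most once, since [phi s] is injective. Hence a convolution
    sum with left factor supported on s has at most one nonzero term. *)
Lemma Delta_Germ_unique s (g g' : Germ tw) : Germ_ran g = Germ_ran g' ->
  Dl s (Germ_lift g) != 0 -> Dl s (Germ_lift g') != 0 -> g = g'.
Proof.
move=> gg' /(Delta_neq0 (Germ_liftP g)) sg /(Delta_neq0 (Germ_liftP g')) sg'.
move: gg'; rewrite !Germ_ranE (germ_coef_phi sg) (germ_coef_phi sg') => gg'.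
have [sx gx [a [c [ax cx E _]]]] := sg; have [sx' gx' [a' [c' [ax' cx' E' _]]]] := sg'.
have xx : Germ_dom g = Germ_dom g' by exact: (phi_inj (tw := tw) sx sx' gg').
rewrite -(reprK g) -(reprK g'); apply/eqmodP/asboolP.
rewrite -/(Germ_dom g) -/(Germ_dom g') -/(Germ_elt g) -/(Germ_elt g'); split=> //.
exists (a * c')%g, (a' * c)%g; split.
- by apply: circle_norm1; apply: T_mul_neq0 => //; rewrite xx.
- by apply: circle_norm1; apply: T_mul_neq0 => //; rewrite xx.
- by rewrite !gmulfM !mulgA E E' -!mulgA iC.
Qed.

Lemma Germ_exists s y : dom s y ->
  exists g : Germ tw, Germ_ran g = phi s y /\ Dl s (Germ_lift g) != 0.
Proof.
move=> sy; have P : `[< dom (s, y).1 (s, y).2 >] by apply/asboolP.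
pose g := \pi_(Germ tw) (exist _ (s, y) P : germ_pair tw).
have : germ_approx (repr g) (exist _ (s, y) P : germ_pair tw) by apply/eqmodP; rewrite reprK.
move=> /asboolP /= [yE [a [c [a1 c1 E]]]].
rewrite -/(Germ_elt g) -/(Germ_dom g) in yE a1 c1 E.
have ay : a (Germ_dom g) != 0 by rewrite -normr_eq0 a1 oner_eq0.
have cy : c (Germ_dom g) != 0 by rewrite -normr_eq0 c1 oner_eq0.
have gy := is_germ_in_dom (Germ_liftP g).
have co : germ_coef s (Germ_elt g) (Germ_dom g) (a (Germ_dom g) * (c (Germ_dom g))^*).
  by split=> //; [rewrite yE|exists a, c].
exists g; split; first by rewrite Germ_ranE (germ_coef_phi co) yE.
by rewrite (Delta_coef (Germ_liftP g) co) (germ_coef_neq0 co).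
Qed.

Lemma germ_coef_mul s t v w x y z z' : dom v y -> dom w x -> phi w x = phi v y ->
  germ_coef s v y z -> germ_coef t (v^* * w)%g x z' ->
  germ_coef (s * t)%g w x (z * z') /\ phi t x = y.
Proof.
move=> vy wx wv sv tvw.
have [sy _ [a [c [ay cy E zE]]]] := sv.
have [tx vwx [al [ga [alx gax E' zE']]]] := tvw.
have ty : phi t x = y by rewrite -(germ_coef_phi tvw) phiM // wv phiK.
split=> //; split=> //; first by apply/domM; rewrite ty.
have [k1 [Ek1 k1x]] := i_comm tw t (c * c^*)%g.
(* The chain is w k2 al = h' w al = v a c^* v^* w al = v a c^* t ga = s c c^* t ga = s t k1 ga. *)
have [h' [Eh' _ h'phi]] := tw_conj tw v (a * c^*)%g.
have [k2 [Ek2 k2x]] := i_comm tw w h'.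
have k1x' : k1 x = 1 by rewrite k1x // ty circle_mulE T_inv.
have k2x' : k2 x = z by rewrite k2x // wv h'phi // circle_mulE zE.
exists (k2 * al)%g, (k1 * ga)%g; split.
- by rewrite T_mul_neq0 // k2x' (germ_coef_neq0 sv).
- by rewrite T_mul_neq0 // k1x' oner_eq0.
- rewrite gmulfM mulgA -Ek2 -Eh' -!mulgA (mulgA (v^*)%g) E'.
  rewrite (gmulfM (s:=i) a) -!mulgA (mulgA v) E (gmulfM (s:=i) k1) (mulgA t) -Ek1 (gmulfM (s:=i) c).
  by rewrite !mulgA.
- by rewrite !circle_mulE k1x' mul1r k2x' zE' mulrA.
Qed.

Lemma germ_coef_div s t v w x y z z3 : dom v y -> dom w x -> phi w x = phi v y ->
  germ_coef s v y z -> germ_coef (s * t)%g w x z3 ->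
  exists z', germ_coef t (v^* * w)%g x z'.
Proof.
move=> vy wx wv sv st.
have [sy _ [a [c [ay cy E zE]]]] := sv.
have [stx _ [al [ga [alx gax E' zE']]]] := st.
have [tx ssx] := (domM tw s t x).1 stx.
have ty : phi t x = y.
  apply: (phi_inj (tw := tw) ssx sy).
  by rewrite -(germ_coef_phi sv) -wv (germ_coef_phi st) phiM.
have vwx : dom (v^* * w)%g x by apply/domM; rewrite wv; split=> //; exact: phi_dom.
have vwphi : phi (v^* * w)%g x = y by rewrite phiM // wv phiK.
(* The star of v a = s c turns a a^* v^* s t ga into a c^* s^* s t ga; the indicator of [dom s]
   stands for s^* s, and the whole factor crosses t as k3. *)
have [k3 [Ek3 k3x]] := i_comm tw t (a * c^* * cind (dom_copen tw s))%g.
have [k4 [Ek4 k4x]] := i_comm tw (v^* * w)%g (a * a^*)%g.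
have k4x' : k4 x = 1 by rewrite k4x // vwphi circle_mulE T_inv.
have k3x' : k3 x != 0.
  rewrite k3x // ty; apply: T_mul_neq0; first by apply: T_mul_neq0 => //; exact: T_conj_neq0.
  by rewrite -[cind _ _]/(ind _ y) ind1 // oner_eq0.
exists ((k4 * al)%g x * ((k3 * ga)%g x)^*); split=> //.
exists (k4 * al)%g, (k3 * ga)%g; split=> //.
- by rewrite T_mul_neq0 // k4x' oner_eq0.
- exact: T_mul_neq0.
- rewrite (gmulfM (s:=i) k4) mulgA -Ek4 (gmulfM (s:=i) k3) (mulgA t) -Ek3.
  rewrite -!mulgA E' !gmulfM i_cind_dom.
  have Es : (i a^* * v^* = i c^* * s^*)%g by rewrite !istar_morph -!istarM E.
  by rewrite -!mulgA (mulgA (i a^*)%g) Es -!mulgA.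
Qed.

(** The only germ that can contribute is that of s with the range of sigma, say [v, y]. There
    [germ_coef_mul] multiplies the two values, and [germ_coef_div] ensures that no value is lost
    when the second factor vanishes. *)
Lemma mono_conv s t (b c : X -> C) : germ_conv tw (mono s b) (mono t c) =
  mono (s * t)%g (fun x => pull tw t b x * c x).
Proof.
apply/funext => sigma; have [w [x wx]] := is_germ_ex sigma.
have dw := is_germ_in_dom wx.
rewrite /germ_conv (germ_ranE wx) [in RHS]/mono (is_germ_dom wx).
have [[g [gw gs]]|nog] :=
    pselect (exists g : Germ tw, Germ_ran g = phi w x /\ Dl s (Germ_lift g) != 0); last first.
  rewrite fsbig1; last first.
    move=> g gw; rewrite /mono; have [->|gs] := eqVneq (Dl s (Germ_lift g)) 0.
      by rewrite !mul0r.
    by case: nog; exists g.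
  rewrite (Delta_no_coef wx) ?mul0r // => z zP; have [stx _ _] := zP.
  have [tx sx] := (domM tw s t x).1 stx.
  have [g [gran gs]] := Germ_exists sx; case: nog; exists g; split=> //.
  by rewrite gran -phiM // -(germ_coef_phi zP).
rewrite -(@fsbig_widen _ _ _ _ [set g]); last 2 first.
- by move=> _ ->.
- move=> g' /= [g'w /eqP g'g]; rewrite /mono.
  have [->|gs'] := eqVneq (Dl s (Germ_lift g')) 0; first by rewrite !mul0r.
  case/eqP: g'g; apply: (@Delta_Germ_unique s) => //; by rewrite gw.
rewrite fsbig_set1.
have gy := Germ_liftP g; set v := Germ_elt g in gy; set y := Germ_dom g in gy.
have vy := is_germ_in_dom gy.
have wv : phi w x = phi v y by rewrite -gw.
have sv := Delta_neq0 gy gs; move: gs sv; set z := Dl s (Germ_lift g) => gs sv.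
have rx : is_germ (germ_mul (germ_inv (Germ_lift g)) sigma) (v^* * w)%g x.
  by apply: is_germ_mul wx _; rewrite wv; exact: is_germ_inv.
rewrite /mono -/z (is_germ_dom gy) (is_germ_dom rx).
have [[z' z'P]|noz] := pselect (exists z', germ_coef t (v^* * w)%g x z').
  have [stP ty] := germ_coef_mul vy dw wv sv z'P.
  rewrite (Delta_coef rx z'P) (Delta_coef wx stP) pullE ?ty; last by case: z'P.
  by rewrite -!mulrA (mulrCA z' (b y)).
rewrite (Delta_no_coef rx); last by move=> z' z'P; apply: noz; exists z'.
rewrite mul0r mulr0 (Delta_no_coef wx) ?mul0r // => z3 z3P; apply: noz.
exact: germ_coef_div vy dw wv sv z3P.
Qed.

(** A sum over a set with infinite support is 0 by convention, so additivity of the convolution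
    needs a finite support in each range fibre. *)
Definition germ_finite (f : Sigma tw -> C) := forall r : X,
  finite_set [set g : Germ tw | Germ_ran g = r /\ f (Germ_lift g) != 0].

Lemma mono_germ_finite s b : germ_finite (mono s b).
Proof.
move=> r.
have [[g [gr gs]]|nog] :=
    pselect (exists g : Germ tw, Germ_ran g = r /\ Dl s (Germ_lift g) != 0); last first.
  rewrite (_ : [set g | _] = set0) //; apply/seteqP; split=> // g [gr].
  rewrite /mono mulf_eq0 negb_or => /andP[gs _]; by case: nog; exists g.
apply: (@sub_finite_set _ _ [set g]); last exact: finite_set1.
move=> g' [g'r]; rewrite /mono mulf_eq0 negb_or => /andP[gs' _].
by apply: (@Delta_Germ_unique s) => //; rewrite gr.
Qed.

Lemma germ_conv_sum (I J : finType) (f : I -> Sigma tw -> C) (f' : J -> Sigma tw -> C) sigma :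
  (forall j, germ_finite (f j)) ->
  germ_conv tw (fun tau => \sum_j f j tau) (fun tau => \sum_j f' j tau) sigma =
  \sum_j \sum_j' germ_conv tw (f j) (f' j') sigma.
Proof.
move=> ff; rewrite /germ_conv; set r := germ_ran sigma.
pose A := \bigcup_(j in [set: I]) [set g : Germ tw | Germ_ran g = r /\ f j (Germ_lift g) != 0].
have fA : finite_set A by apply: bigcup_finite => // j _; exact: ff.
have A0 g j : ~ A g -> Germ_ran g = r -> f j (Germ_lift g) = 0.
  by move=> nAg gr; apply/eqP; apply: contra_notT nAg => fg; exists j.
have Ar : A `<=` [set g | Germ_ran g = r] by move=> g [j _ []].
rewrite -(@fsbig_widen _ _ _ _ A) //; last first.
  by move=> g /= [gr nAg]; rewrite big1 ?mul0r // => j _; exact: A0.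
rewrite fsbig_finite //=.
under eq_bigr do rewrite mulr_suml.
rewrite exchange_big; apply: eq_bigr => j _.
under eq_bigr do rewrite mulr_sumr.
rewrite exchange_big; apply: eq_bigr => j' _.
rewrite -(@fsbig_widen _ _ _ _ A) //; last first.
  by move=> g /= [gr nAg]; rewrite (A0 g j) // mul0r.
by rewrite fsbig_finite.
Qed.

End Convolution.

(** * Restriction to the unit space *)

Section UnitSpace.
Context {R : realType} {X : booleanSpaceType} {G S : invSemigroupType}
  {D : dualSpace X G}.
Variable tw : twist R S D.
Local Notation T := (circleFun R X).
Local Notation C := (Cplx R).
Local Notation p := (tw_p tw).
Local Notation i := (tw_i tw).
Local Notation dom := (bis_dom D p).
Local Notation phi := (dual_map D p).
Local Notation Dl s := (Delta (@bisection R X G S D tw s)).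
Local Notation mono := (mono (tw := tw)).
Implicit Types (s t : S) (x y : X) (h : T) (b c : X -> C) (sigma : Sigma tw).

(** T(X) has no global unit when X is not compact; a local one at each point lets [unit_ext] be
    defined for all b, without reference to a support. *)
Definition unit_at x : T := xget circle_zero [set h : T | h x = 1].

Lemma unit_atE x : unit_at x x = 1.
Proof.
have [U [Uco Ux _]] := @boolean_base X x setT filterT.
have H : [set h : T | h x = 1] (cind Uco) by rewrite /= -[LHS]/(ind U x) ind1.
exact: (xgetPex circle_zero (ex_intro _ _ H)).
Qed.

(* The values of the function b on the unit space, extended to the unit
   bundle of Sigma by equivariance and by 0 elsewhere. *)
Definition unit_ext b sigma : C :=
  Dl (i (unit_at (germ_dom sigma))) sigma * b (germ_dom sigma).

(** Both sides are [Delta] of the product of h with the local unit, evaluated by [Delta_mul_i] in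
    the two orders. *)
Lemma Delta_i h sigma : Dl (i h) sigma = unit_ext h sigma.
Proof.
rewrite /unit_ext mulrC -Delta_mul_i iC Delta_mul_i.
by rewrite unit_atE mul1r.
Qed.

Lemma mono_eq s b c : (forall x, dom s x -> b x = c x) -> mono s b = mono s c.
Proof.
move=> bc; apply/funext => sigma; rewrite /mono.
have [sx|sx] := pselect (dom s (germ_dom sigma)); first by rewrite bc.
by rewrite Delta_off // !mul0r.
Qed.

Lemma unit_ext_mono (V : set X) (Vco : copen V) b : (forall x, ~ V x -> b x = 0) ->
  unit_ext b = mono (i (cind Vco)) b.
Proof.
move=> bV; apply/funext => sigma; rewrite /mono Delta_i /unit_ext.
rewrite -[cind _ _]/(ind V _).
have [Vx|nVx] := pselect (V (germ_dom sigma)); first by rewrite ind1 // mulr1.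
by rewrite bV // !mulr0.
Qed.

Lemma Delta_mono s : Dl s = mono s (ind (dom s)).
Proof.
apply/funext => sigma; rewrite /mono.
have [sx|sx] := pselect (dom s (germ_dom sigma)); first by rewrite ind1 // mulr1.
by rewrite Delta_off // mul0r.
Qed.

Lemma mono_mul_i s h b : mono (s * i h)%g b = mono s (fun x => h x * b x).
Proof. by apply/funext => sigma; rewrite /mono Delta_mul_i mulrAC mulrA mulrC !mulrA. Qed.

Lemma Delta_unit_ext_conv s b : Cc b -> mono s b = germ_conv tw (Dl s) (unit_ext b).
Proof.
move=> /CcP[_ [V Vco bV]].
rewrite (unit_ext_mono Vco bV) Delta_mono mono_conv mono_mul_i; apply: mono_eq => x sx.
rewrite -[cind _ _]/(ind V _).
have [Vx|nVx] := pselect (V x); last by rewrite bV // !mulr0.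
have Vx0 : (cind Vco : T) x != 0 by rewrite -[cind _ _]/(ind V _) ind1 // oner_eq0.
by rewrite pullE ?phi_i // ?dom_i // !ind1 // !mul1r.
Qed.

Lemma pull_i_supp h b x : h x != 0 -> pull tw (i h) b x = b x.
Proof. by move=> hx; rewrite pullE ?phi_i // dom_i. Qed.

Lemma unit_extM b c : Cc b -> Cc c ->
  unit_ext (fun x => b x * c x) = germ_conv tw (unit_ext b) (unit_ext c).
Proof.
move=> /CcP[_ [U Uco bU]] /CcP[_ [V Vco cV]].
have Wco := copenU Uco Vco; pose W := U `|` V.
have bW x : ~ W x -> b x = 0 by move=> nW; apply: bU => Ux; apply: nW; left.
have cW x : ~ W x -> c x = 0 by move=> nW; apply: cV => Vx; apply: nW; right.
have bcW x : ~ W x -> b x * c x = 0 by move=> nW; rewrite bW // mul0r.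
rewrite (unit_ext_mono Wco bW) (unit_ext_mono Wco cW) (unit_ext_mono Wco bcW).
rewrite mono_conv mono_mul_i; apply: mono_eq => x /dom_i Wx.
rewrite pull_i_supp //; rewrite -[cind _ _]/(ind W _) in Wx *.
by rewrite /ind in Wx *; move: Wx; case: (x \in W); rewrite ?eqxx // mul1r.
Qed.

Lemma unit_extJ b : Cc b -> unit_ext (fun x => (b x)^*) = germ_star tw (unit_ext b).
Proof.
move=> /CcP[_ [V Vco bV]].
have bV' x : ~ V x -> (b x)^* = 0 by move=> nV; rewrite bV // conjC0.
rewrite (unit_ext_mono Vco bV) (unit_ext_mono Vco bV') mono_star -istar_morph.
have -> : ((cind Vco : T)^*)%g = cind Vco.
  by apply: circleP => x /=; rewrite rmorph_nat.
by apply: mono_eq => x /dom_i Vx; rewrite pull_i_supp.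
Qed.

Lemma twisted_mono_sum (J : finType) (s : J -> S) (b : J -> X -> C) :
  (forall j, Cc (b j)) -> twisted_Cc tw (fun sigma => \sum_j mono (s j) (b j) sigma).
Proof.
move=> Cb; exists #|J|, (fun k => s (enum_val (A := J) k)), (fun k => b (enum_val (A := J) k)).
split=> // ; apply/funext => sigma.
by rewrite (big_enum_val (A := J)).
Qed.

Lemma twisted_mono_seq (J : Type) (l : seq J) (s : J -> S) (b : J -> X -> C) :
  (forall j, Cc (b j)) -> twisted_Cc tw (fun sigma => \sum_(j <- l) mono (s j) (b j) sigma).
Proof.
move=> Cb; case: l => [|j0 l].
  rewrite (_ : (fun _ => _) = fun sigma => \sum_(k : void) mono (of_void S k) (of_void (X -> C) k) sigma).
    by apply: twisted_mono_sum; case.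
  by apply/funext => sigma; rewrite big_nil big_pred0 // => -[].
rewrite (_ : (fun _ => _) = fun sigma => \sum_(k : 'I_(size (j0 :: l)))
    mono (s (nth j0 (j0 :: l) k)) (b (nth j0 (j0 :: l) k)) sigma).
  exact: twisted_mono_sum.
by apply/funext => sigma; rewrite (big_nth j0) big_mkord.
Qed.

Lemma twisted_mono s b : Cc b -> twisted_Cc tw (mono s b).
Proof.
move=> Cb; rewrite (_ : mono s b = fun sigma => \sum_(k : unit) mono s b sigma).
  exact: twisted_mono_sum.
by apply/funext => sigma; rewrite big_const card_unit /= addr0.
Qed.

Lemma twisted_unit_ext b : Cc b -> twisted_Cc tw (unit_ext b).
Proof.
by move=> Cb; have /CcP[_ [V Vco bV]] := Cb; rewrite (unit_ext_mono Vco bV); exact: twisted_mono.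
Qed.

Lemma Delta_istar s : Dl (s^*)%g = germ_star tw (Dl s).
Proof.
rewrite !Delta_mono mono_star; apply: mono_eq => x sx.
by rewrite pullE // !ind1 ?conjC1 //; exact: dom_istar_phi.
Qed.

Lemma DeltaM s t : Dl (s * t)%g = germ_conv tw (Dl s) (Dl t).
Proof.
rewrite !Delta_mono mono_conv; apply: mono_eq => x stx; have [tx sx] := (domM tw s t x).1 stx.
by rewrite pullE // !ind1 // mulr1.
Qed.

Lemma Delta_zero sigma : Dl izero sigma = 0.
Proof. by rewrite Delta_off //; exact: dom_zero. Qed.

(** The idempotent that restricts t to s can always be taken to be s^* s, the indicator of
    [dom s]. *)
Lemma ileE s t : ile s t -> exists2 h : T, s = (t * i h)%g & (forall x, h x = ind (dom s) x).
Proof.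
move=> [e ee ->]; exists (cind (dom_copen tw (t * e)%g)) => //.
rewrite i_cind_dom istarM (idem_istar ee).
have -> : (t * (e * t^* * (t * e)) = t * (e * (t^* * t) * e))%g by rewrite !mulgA.
rewrite (idem_mulC ee (idem_dom t)) -(mulgA _ e e) ee.
by rewrite !mulgA mulKs.
Qed.

(** A common point x of the domains would put [phi t x] in the domain of s t^* = 0. On [dom s] and
    [dom t] the join restricts to s and t; outside both it has no domain, by minimality. *)
Lemma Delta_join s t j : orthogonal_pair s t -> is_join s t j ->
  forall sigma, Dl j sigma = Dl s sigma + Dl t sigma.
Proof.
move=> [_ st0] [sj tj jmin] sigma.
have [h sE hP] := ileE sj; have [k tE kP] := ileE tj.
set x := germ_dom sigma.
have disj : dom s x -> dom t x -> False.
  move=> sx tx; apply: (@dom_zero _ _ _ _ _ tw (phi t x)); rewrite -st0; apply/domM.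
  by rewrite phiK //; split=> //; exact: phi_dom.
have [sx|sx] := pselect (dom s x).
  rewrite [Dl t _]Delta_off ?addr0; last by move=> tx; exact: disj tx.
  by rewrite sE Delta_mul_i hP ind1 // mul1r.
rewrite [Dl s _]Delta_off // add0r.
have [tx|tx] := pselect (dom t x); first by rewrite tE Delta_mul_i kP ind1 // mul1r.
rewrite [Dl t _]Delta_off // Delta_off // => jx.
have Wco := copenU (dom_copen tw s) (dom_copen tw t).
(* Cutting j down to the union W of the two domains still leaves an upper bound of s and t, so the
   join lies below it. *)
have below r q : (r = j * i q)%g -> (forall y, q y = ind (dom r) y) ->
    dom r `<=` dom s `|` dom t -> ile r (j * i (cind Wco))%g.
  move=> rE qP rW; exists (i q).
    rewrite /idem -gmulfM; congr (i _); apply: circleP => y.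
    by rewrite circle_mulE !qP /ind; case: (y \in _); rewrite ?mul1r ?mul0r.
  rewrite -mulgA -gmulfM rE; congr (_ * i _)%g; apply: circleP => y.
  rewrite circle_mulE qP -[cind _ _]/(ind _ y); have [ry|ry] := pselect (dom r y).
    by rewrite !ind1 ?mulr1 //; exact: rW.
  by rewrite (ind0 ry) mulr0.
have jle : ile j (j * i (cind Wco))%g.
  by apply: jmin; [apply: below sE hP _; left|apply: below tE kP _; right].
have [q jE qP] := ileE jle.
have qx : q x != 0 by rewrite qP ind1 // oner_eq0.
move: jx; rewrite jE => /domM[_]; rewrite phi_i // => /domM[/dom_i].
rewrite -[cind _ _]/(ind _ x) => Wx _; apply/negP: Wx; rewrite negbK.
by rewrite ind0 // => -[].
Qed.

End UnitSpace.

(** * From representations of the algebra to representations of the twist *)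

Section AlgebraRepresentation.
Context {R : realType} {X : booleanSpaceType} {G S : invSemigroupType}
  {D : dualSpace X G}.
Variables (tw : twist R S D) (K : hilbertType R).
Local Notation T := (circleFun R X).
Local Notation C := (Cplx R).
Local Notation i := (tw_i tw).
Local Notation Dl s := (Delta (@bisection R X G S D tw s)).
Local Notation uext := (unit_ext (tw := tw)).
Implicit Types (s t : S) (x y : X) (h : T) (b c : X -> C) (u v : K).

Section OneRepresentation.
Variable rho : twisted_Cc tw -> boundedOp K.
Hypothesis rhoP : Cc_rep rho.
Local Notation tot := (total_rep rho).

Lemma Delta_funE s u : rho (Delta_fun tw s) u = tot (Dl s) u.
Proof. exact: esym (total_rep_exist rho (mem_set (@Delta_in _ _ _ _ _ tw s)) u). Qed.

Lemma unit_rep_Cc_op : Cc_op (fun b => tot (uext b)).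
Proof.
split.
- by move=> b; exact: total_rep_linear.
- move=> b c Cb Cc_c; apply: (total_repD rhoP).
  + exact: twisted_unit_ext.
  + exact: twisted_unit_ext.
  + apply: twisted_unit_ext; exact: CcD.
  + by move=> sigma; rewrite /unit_ext mulrDr.
- move=> k b Cb; apply: (total_repZ rhoP).
  + exact: twisted_unit_ext.
  + apply: twisted_unit_ext; exact: CcZ.
  + by move=> sigma; rewrite /unit_ext mulrCA.
- move=> b c Cb Cc_c; apply: (total_repM rhoP).
  + exact: twisted_unit_ext.
  + exact: twisted_unit_ext.
  + apply: twisted_unit_ext; exact: CcM.
  + exact: unit_extM.
- move=> b Cb; apply: (total_repJ rhoP).
  + exact: twisted_unit_ext.
  + apply: twisted_unit_ext; exact: Cc_conj.
  + exact: unit_extJ.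
Qed.

Lemma tot_mono s b u : Cc b -> tot (mono (tw:=tw) s b) u = tot (Dl s) (tot (uext b) u).
Proof.
move=> Cb; apply: (total_repM rhoP).
- exact: Delta_in.
- exact: twisted_unit_ext.
- exact: twisted_mono.
- exact: Delta_unit_ext_conv.
Qed.

Lemma tot_circle h u : tot (uext h) u = rho (Delta_fun tw (i h)) u.
Proof.
by rewrite Delta_funE; congr (tot _ u); apply/funext => sigma; rewrite Delta_i.
Qed.

Lemma Delta_fun_twist_rep : twist_rep tw (fun s => rho (Delta_fun tw s)).
Proof.
have Din s := @Delta_in _ _ _ _ _ tw s.
split.
- move=> s t u; rewrite !Delta_funE; apply: (total_repM rhoP) => //; exact: DeltaM.
- move=> s u v; rewrite !Delta_funE; apply: (total_repJ rhoP) => //; exact: Delta_istar.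
- move=> s t j st stj u; rewrite !Delta_funE; apply: (total_repD rhoP) => //.
  exact: Delta_join st stj.
- move=> u; rewrite !Delta_funE -(scale0r (tot (Dl izero) u)).
  by apply: (total_repZ rhoP) => // sigma; rewrite Delta_zero mul0r.
have [r [rP rE]] := C0_extension_exists unit_rep_Cc_op.
have rh h : r (circle_to_C0 h) = rho (Delta_fun tw (i h)).
  by apply: boundedOpP => u; rewrite rE ?tot_circle //; exact: Cc_circle.
by exists r => // ; split=> // h _.
Qed.

End OneRepresentation.

Lemma Cc_rep_inj (rho rho' : twisted_Cc tw -> boundedOp K) :
  Cc_rep rho -> Cc_rep rho' ->
  (forall s, rho (Delta_fun tw s) = rho' (Delta_fun tw s)) -> rho = rho'.
Proof.
move=> rhoP rhoP' E.
have r1 := unit_rep_Cc_op rhoP; have r2 := unit_rep_Cc_op rhoP'.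
have Eu b : Cc b -> forall u, total_rep rho (uext b) u = total_rep rho' (uext b) u.
  move: b; apply: Cc_density.
  - by move=> U Uco u; have := tot_circle rho (cind Uco) u; rewrite E -tot_circle.
  - move=> b c Cb Cc_c Eb Ec u.
    by rewrite (Cc_opD r1 Cb Cc_c) (Cc_opD r2 Cb Cc_c) Eb Ec.
  - by move=> k b Cb Eb u; rewrite (Cc_opZ r1 k Cb) (Cc_opZ r2 k Cb) Eb.
  - move=> b Cb bP u; apply: (@eq_arbitrarily_close _ _ _ _ (`|u| + `|u|)).
      by rewrite addr_ge0.
    move=> e e0 _; have [c [Cc_c Ec bc]] := bP e e0.
    rewrite -(subrK (total_rep rho (uext c) u) (total_rep rho (uext b) u)).
    rewrite -addrA mulrDr; apply: (le_trans (ler_normD _ _)); apply: lerD.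
      exact: (Cc_op_close r1 u Cb Cc_c (ltW e0) bc).
    by rewrite Ec distrC; exact: (Cc_op_close r2 u Cb Cc_c (ltW e0) bc).
apply/funext => f; apply: boundedOpP => u; rewrite -!total_repE.
have [n [s [b [Cb ->]]]] := set_valP f.
have tms (l : seq 'I_n) := twisted_mono_seq tw l s Cb.
have tm (k : 'I_n) := twisted_mono tw (s k) (Cb k).
rewrite (total_rep_sum rhoP) // (total_rep_sum rhoP') //; apply: eq_bigr => k _.
rewrite (tot_mono rhoP) // (tot_mono rhoP') // -(Delta_funE rho) -(Delta_funE rho').
by rewrite E Eu.
Qed.

End AlgebraRepresentation.

(** * From representations of the twist to representations of the algebra *)

Section TwistRepresentation.
Context {R : realType} {X : booleanSpaceType} {G S : invSemigroupType}
  {D : dualSpace X G}.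
Variables (tw : twist R S D) (K : hilbertType R) (pi : S -> boundedOp K).
Local Notation T := (circleFun R X).
Local Notation C := (Cplx R).
Local Notation p := (tw_p tw).
Local Notation i := (tw_i tw).
Local Notation dom := (bis_dom D p).
Local Notation Dl s := (Delta (@bisection R X G S D tw s)).
Local Notation mono := (mono (tw := tw)).
Local Notation is_germ := (@is_germ R X G S D tw).
Local Notation germ_coef := (germ_coef tw).
Implicit Types (s t : S) (x y : X) (h : T) (b c : X -> C) (u v : K).

Hypothesis piP : twist_rep tw pi.
Variable r : (X -> C) -> K -> K.
Hypothesis rP : Cc_op r.
Hypothesis r_circle : forall h u, pi (i h) u = r h u.

Lemma boundedOpD (a : boundedOp K) u v : a (u + v) = a u + a v.
Proof. by have := bop_linear a 1 u v; rewrite !scale1r. Qed.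

Lemma boundedOp0 (a : boundedOp K) : a 0 = 0.
Proof. by apply: (@addrI _ (a 0)); rewrite -boundedOpD !addr0. Qed.

Lemma boundedOpZ (a : boundedOp K) k u : a (k *: u) = k *: a u.
Proof. by have := bop_linear a k u 0; rewrite boundedOp0 !addr0. Qed.

Lemma boundedOpB (a : boundedOp K) u v : a (u - v) = a u - a v.
Proof. by rewrite -scaleN1r boundedOpD boundedOpZ scaleN1r. Qed.

Lemma boundedOp_sum (a : boundedOp K) (J : Type) (l : seq J) (P : pred J) (z : J -> K) :
  a (\sum_(j <- l | P j) z j) = \sum_(j <- l | P j) a (z j).
Proof.
by elim/big_rec2: _ => [|j y1 y2 _ <-]; [exact: boundedOp0|exact: boundedOpD].
Qed.

Lemma pi_dom s u : pi s (r (ind (dom s)) u) = pi s u.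
Proof.
rewrite -[ind _]/(circle_fun (cind (dom_copen tw s))) -r_circle -(twist_repM piP).
by rewrite i_cind_dom mulgA mulKs.
Qed.

(** The squared norm of pi(s)u is the inner product of pi(s^* s)u with u, and s^* s acts as a
    projection. *)
Lemma pi_contraction s u : `|pi s u| <= `|u|.
Proof.
rewrite -(@ler_pXn2r _ 2) ?nnegrE ?normr_ge0 // hdot_norm -(twist_repJ piP).
rewrite -(twist_repM piP) -(i_cind_dom tw) r_circle.
rewrite -(Cc_op_ind_normsq rP _ (dom_copen tw s)).
by rewrite ler_pXn2r ?nnegrE ?normr_ge0 // (Cc_op_ind_norm rP _ (dom_copen tw s)).
Qed.

Lemma pi_mul_i s h b u : Cc b -> pi (s * i h)%g (r b u) = pi s (r (fun x => h x * b x) u).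
Proof.
by move=> Cb; rewrite (twist_repM piP) r_circle (Cc_opM rP (Cc_circle h) Cb).
Qed.

(* Checked on step functions, where it is multiplicativity of pi. *)
Lemma r_pi_commute t b : Cc b -> forall u, r b (pi t u) = pi t (r (pull tw t b) u).
Proof.
have Cp c : Cc c -> Cc (pull tw t c) by move=> [cc _]; exact: Cc_pull.
move: b; apply: Cc_density.
- move=> U Uco u; have [k [Ek kE]] := i_comm_pull tw t (cind Uco).
  rewrite -[pull _ _ _]/(pull tw t (cind Uco : T)) -kE -r_circle -(twist_repM piP) -Ek.
  by rewrite (twist_repM piP) r_circle.
- move=> b c Cb Cc_c Eb Ec u.
  rewrite (Cc_opD rP Cb Cc_c) Eb Ec -boundedOpD -(Cc_opD rP (Cp _ Cb) (Cp _ Cc_c)).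
  congr (pi t (r _ u)); apply/funext => x.
  by have [tx|tx] := pselect (dom t x); [rewrite !pullE|rewrite !pull0 ?addr0].
- move=> k b Cb Eb u; rewrite (Cc_opZ rP _ Cb) Eb -boundedOpZ -(Cc_opZ rP _ (Cp _ Cb)).
  congr (pi t (r _ u)); apply/funext => x.
  by have [tx|tx] := pselect (dom t x); [rewrite !pullE|rewrite !pull0 ?mulr0].
- move=> b Cb bP u; apply: (@eq_arbitrarily_close _ _ _ _ (`|pi t u| + `|u|)).
    by rewrite addr_ge0.
  move=> e e0 _; have [c [Cc_c Ec bc]] := bP e e0.
  rewrite -(subrK (r c (pi t u)) (r b (pi t u))).
  rewrite -addrA mulrDr; apply: (le_trans (ler_normD _ _)); apply: lerD.
    exact: (Cc_op_close rP _ Cb Cc_c (ltW e0) bc).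
  rewrite Ec -boundedOpB; apply: (le_trans (pi_contraction _ _)).
  apply: (Cc_op_close rP _ (Cp _ Cc_c) (Cp _ Cb) (ltW e0)) => x.
  have [tx|tx] := pselect (dom t x); first by rewrite !pullE // distrC.
  by rewrite !pull0 // subrr normr0 ltW.
Qed.

(** The existence of a coefficient means that s and t have the same class in G at x; this lemma and
    the next two are the laws of that equivalence. *)
Lemma germ_coef_sym s t x z : germ_coef s t x z -> exists z', germ_coef t s x z'.
Proof.
move=> [sx tx [a [c [ax cx E _]]]]; exists (c x * (a x)^*); split=> //.
by exists c, a.
Qed.

Lemma germ_coef_trans s t w x z z' : germ_coef s t x z -> germ_coef w s x z' ->
  exists z'', germ_coef w t x z''.
Proof.
move=> [sx tx [a [c [ax cx E _]]]] [vx _ [a' [c' [ax' cx' E' _]]]].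
exists ((a * a')%g x * ((c' * c)%g x)^*); split=> //.
exists (a * a')%g, (c' * c)%g; split=> //; [exact: T_mul_neq0|exact: T_mul_neq0|].
by rewrite !gmulfM !mulgA E -[LHS]mulgA iC mulgA E'.
Qed.

Lemma germ_coef_self s x : dom s x -> exists z, germ_coef s s x z.
Proof.
move=> sx; pose a := cind (R := R) (dom_copen tw s).
have ax : a x != 0 by rewrite -[a _]/(ind _ x) ind1 // oner_eq0.
by exists (a x * (a x)^*); split=> //; exists a, a.
Qed.

(** * Independence of the expression as a sum *)

Section WellDefined.
Variables (J : finType) (s : J -> S) (b : J -> X -> C).
Hypothesis Cb : forall j, Cc (b j).
Hypothesis sum0 : forall sigma, \sum_j mono (s j) (b j) sigma = 0.

Let same_germ x (j l : J) : bool := `[< exists z, germ_coef (s l) (s j) x z >].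

(* A canonical choice of an index in the class of j modulo equality of the germs at x. *)
Let leader x j := odflt j [pick l | same_germ x j l].

Let leaderP x j : dom (s j) x -> same_germ x j (leader x j).
Proof.
move=> jx; rewrite /leader; case: pickP => [l //|/(_ j)].
by move/asboolP: (germ_coef_self jx); rewrite /same_germ => ->.
Qed.

Let leader_eq x j l : same_germ x j l -> leader x j = leader x l.
Proof.
move=> jl; have E k : same_germ x j k = same_germ x l k.
  move/asboolP: jl => [z jl]; have [z' lj] := germ_coef_sym jl.
  apply/asboolP/asboolP => -[z'' ]; [exact: germ_coef_trans lj|exact: germ_coef_trans jl].
rewrite /leader (eq_pick E); case: pickP => // /(_ l).
have lx : dom (s l) x by move/asboolP: jl => [z []].
by move/asboolP: (germ_coef_self lx); rewrite /same_germ => ->.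
Qed.

Let local_term x j : exists (U : set X) (h : X -> C), [/\ nbhs x U, continuous h,
  forall W, copen W -> W `<=` U -> forall u, pi (s j) (r (fun y => ind W y * b j y) u) =
    pi (s (leader x j)) (r (fun y => ind W y * (h y * b j y)) u),
  forall sigma, is_germ sigma (s (leader x j)) x -> Dl (s j) sigma = h x &
  ~ dom (s j) x -> h x = 0].
Proof.
have [jx|jx] := pselect (dom (s j) x); last first.
  exists (~` dom (s j)), (fun=> 0); split=> //.
  - apply: open_nbhs_nbhs; split=> //; apply: closed_openC.
    exact: copen_closed (dom_copen tw (s j)).
  - by move=> y; exact: cvg_cst.
  - move=> W Wco WU u; have CW := CcI Wco (Cb j).
    rewrite -pi_dom -(Cc_opM rP (Cc_ind (dom_copen tw (s j))) CW).
    rewrite (_ : (fun y => _) = fun=> 0); last first.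
      apply/funext => y; have [Wy|nWy] := pselect (W y); last by rewrite (ind0 nWy) mul0r mulr0.
      by rewrite ind0 ?mul0r //; exact: WU.
    rewrite (_ : (fun y => ind W y * _) = fun=> 0); last by apply/funext => y; rewrite mul0r mulr0.
    by rewrite (Cc_op0 rP) !boundedOp0.
  - by move=> sigma sx; rewrite Delta_off // (is_germ_dom sx).
(* From s_j a = s_l c it follows that s_j agrees with s_l c a^* on the support of a; this gives both
   the neighbourhood and the factor h. *)
have /asboolP[z [lx _ [a [c [ax cx E zE]]]]] := leaderP jx.
set l := leader x j in lx E *.
have E' : (s j * i (a * a^*) = s l * i (c * a^*))%g by rewrite !gmulfM !mulgA E.
exists (dom (i a)), (c * a^*)%g; split.
- by apply: open_nbhs_nbhs; split; [exact: (dom_copen tw (i a)).2|exact/dom_i].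
- exact: circle_continuous.
- move=> W Wco WU u; have CW := CcI Wco (Cb j).
  have -> : (fun y => ind W y * b j y) = (fun y => (a * a^*)%g y * (ind W y * b j y)).
    apply/funext => y; have [Wy|nWy] := pselect (W y); last by rewrite (ind0 nWy) !mul0r mulr0.
    by rewrite circle_mulE T_inv ?mul1r //; apply/(dom_i tw); exact: WU.
  rewrite -pi_mul_i // E' pi_mul_i //; congr (pi _ (r _ u)).
  by apply/funext => y; rewrite mulrCA.
- move=> sigma sx; apply: (Delta_coef sx); split=> //.
  by exists c, a; split.
- by [].
Qed.

Let local_bound x (e : C) : 0 < e -> exists2 U : set X, nbhs x U &
  forall W, copen W -> W `<=` U -> exists g : J -> X -> C,
  [/\ forall l, Cc (g l), forall l y, `|g l y| <= e, forall l y, ~ W y -> g l y = 0 &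
  forall u, \sum_j pi (s j) (r (fun y => ind W y * b j y) u) = \sum_l pi (s l) (r (g l) u)].
Proof.
move=> e0; have [U /choice[h hP]] := choice (local_term x).
pose F l y := \sum_(j | leader x j == l) h j y * b j y.
have CF l : Cc (F l).
  by apply: Cc_sum => j; apply: CcMl (Cb j); case: (hP j).
have Fx l : F l x = 0.
  have [[j [jx jl]]|nol] := pselect (exists j, dom (s j) x /\ leader x j = l); last first.
    apply: big1 => j /eqP jl; have [_ _ _ _ ->] := hP j; first by rewrite mul0r.
    by move=> jx; apply: nol; exists j.
  have lx : dom (s l) x by have /asboolP[z []] := leaderP jx; rewrite jl.
  (* The vanishing sum is evaluated at the germ [s_l, x]: indices with leader l contribute h_j(x)
     b_j(x), and a nonzero term forces its index to have leader l. *)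
  have [sigma sx] := is_germ_intro lx.
  rewrite -[RHS](sum0 sigma) /F [LHS]big_mkcond; apply: eq_bigr => k _.
  rewrite /mono (is_germ_dom sx); case: eqP => [kl|kl].
    by have [_ _ _ /(_ sigma) -> //] := hP k; rewrite kl.
  have [->|nz] := eqVneq (Dl (s k) sigma) 0; first by rewrite mul0r.
  case: kl; have kz := Delta_neq0 sx nz.
  have lk : same_germ x l k by apply/asboolP; exists (Dl (s k) sigma).
  rewrite -(leader_eq lk) -jl; apply/esym/leader_eq.
  by have := leaderP jx; rewrite jl.
exists [set y | forall j, U j y /\ `|F j y| <= e].
  apply: filter_forall => j; apply: filterI; first by case: (hP j).
  by have := continuous_near_le x (CF j).1 e0; apply: filterS => y /=; rewrite Fx subr0.
move=> W Wco WU; exists (fun l y => ind W y * F l y); split.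
- by move=> l; exact: CcI Wco (CF l).
- move=> l y; have [Wy|nWy] := pselect (W y).
    by rewrite ind1 // mul1r; exact: (WU y Wy l).2.
  by rewrite ind0 // mul0r normr0 ltW.
- by move=> l y nWy; rewrite ind0 // mul0r.
move=> u; transitivity (\sum_j pi (s (leader x j)) (r (fun y => ind W y * (h j y * b j y)) u)).
  by apply: eq_bigr => j _; have [_ _ + _ _] := hP j; apply=> // y /WU/(_ j)[].
rewrite (partition_big (leader x) predT) //=; apply: eq_bigr => l _.
have -> : (fun y => ind W y * F l y) =
    (fun y => \sum_(j | leader x j == l) ind W y * (h j y * b j y)).
  by apply/funext => y; rewrite mulr_sumr.
rewrite (Cc_op_sum rP); last first.
  by move=> j; apply: CcI Wco _; apply: CcMl (Cb j); case: (hP j).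
by rewrite boundedOp_sum; apply: eq_bigr => j /eqP ->.
Qed.

Let copen_support (l : seq J) : exists2 V, copen V & forall j, j \in l -> forall x, ~ V x -> b j x = 0.
Proof.
elim: l => [|j l [V Vco VP]]; first by exists set0 => //; exact: copen0.
have [_ [U Uco UP]] := (CcP (b j)).1 (Cb j).
exists (U `|` V); first exact: copenU.
move=> k; rewrite inE => /predU1P[->|kl] x nUV.
  by apply: UP => Ux; apply: nUV; left.
by apply: (VP k kl) => Vx; apply: nUV; right.
Qed.

Lemma sum_pi_eq0 u : \sum_j pi (s j) (r (b j) u) = 0.
Proof.
have [V Vco VP] := copen_support (enum J).
have {}VP j x : ~ V x -> b j x = 0 by apply: VP; rewrite mem_enum.
(* Each index in J will contribute at most e times the norm of u; the constant must not depend on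
   e. *)
apply: (@eq_arbitrarily_close _ _ _ _ (\sum_(l : J) `|u|)); first exact: sumr_ge0.
move=> e e0 _; rewrite subr0 mulr_sumr.
have [g [Cg ge _ gE]] : exists g : J -> X -> C,
    [/\ forall l, Cc (g l), forall l y, `|g l y| <= e, forall l y, ~ V y -> g l y = 0 &
    forall u, \sum_j pi (s j) (r (fun y => ind V y * b j y) u) = \sum_l pi (s l) (r (g l) u)].
  (* Adding g and g' keeps the bound e instead of 2e, because they vanish outside disjoint sets. *)
  apply: (@copen_ind X (fun W => exists g : J -> X -> C,
    [/\ forall l, Cc (g l), forall l y, `|g l y| <= e, forall l y, ~ W y -> g l y = 0 &
    forall u, \sum_j pi (s j) (r (fun y => ind W y * b j y) u) =
      \sum_l pi (s l) (r (g l) u)]) V Vco).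
  - exists (fun _ _ => 0); split; [by move=> l; exact: Cc0|by move=> l y; rewrite normr0 ltW| |].
      by [].
    move=> w; apply: eq_bigr => j _; congr (pi _ (r _ w)); apply/funext => y.
    by rewrite ind0 // mul0r.
  - by move=> x _; exact: local_bound.
  - move=> W W' Wco W'co WW' [g [Cg ge gW gE]] [g' [Cg' ge' gW' gE']].
    have disj y : W y -> ~ W' y by move=> Wy W'y; rewrite -[False]/(set0 y) -WW'.
    exists (fun l y => g l y + g' l y); split.
    + by move=> l; exact: CcD.
    + move=> l y; have [Wy|nWy] := pselect (W y).
        by rewrite gW' ?addr0 //; exact: disj.
      by rewrite gW // add0r.
    + by move=> l y /not_orP[nW nW']; rewrite gW // gW' // addr0.
    + move=> w; rewrite [RHS](eq_bigr (fun l => pi (s l) (r (g l) w) + pi (s l) (r (g' l) w))).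
        rewrite big_split /= -gE -gE' -big_split; apply: eq_bigr => j _ /=.
        rewrite -boundedOpD -(Cc_opD rP (CcI Wco (Cb j)) (CcI W'co (Cb j))).
        congr (pi _ (r _ w)); apply/funext => y; rewrite -mulrDl; congr (_ * _).
        have [Wy|nWy] := pselect (W y).
          have WW'y : (W `|` W') y by left.
          by rewrite (ind1 WW'y) (ind1 Wy) (ind0 (disj y Wy)) addr0.
        rewrite (ind0 nWy) add0r; have [W'y|nW'y] := pselect (W' y).
          have WW'y : (W `|` W') y by right.
          by rewrite (ind1 WW'y) (ind1 W'y).
        by rewrite !ind0 // => -[].
      by move=> l _; rewrite (Cc_opD rP) // boundedOpD.
have -> : \sum_j pi (s j) (r (b j) u) = \sum_l pi (s l) (r (g l) u).
  rewrite -gE; apply: eq_bigr => j _; congr (pi _ (r _ u)); apply/funext => y.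
  by have [Vy|nVy] := pselect (V y); [rewrite ind1 // mul1r|rewrite VP // mulr0].
apply: (le_trans (ler_norm_sum _ _ _)); apply: ler_sum => l _.
apply: (le_trans (pi_contraction _ _)).
exact: (Cc_op_bound rP u (Cg l) (ltW e0) (ge l)).
Qed.

End WellDefined.

Lemma sum_pi_bounded (J : finType) (s : J -> S) (b : J -> X -> C) :
  (forall j, Cc (b j)) ->
  exists a : boundedOp K, forall u, a u = \sum_j pi (s j) (r (b j) u).
Proof.
move=> Cb; have /choice[M MP] : forall j, exists M : C, 0 <= M /\ forall x, `|b j x| <= M.
  by move=> j; have [M M0 bM] := Cc_bounded (Cb j); exists M.
have lin : linear (fun u => \sum_j pi (s j) (r (b j) u)).
  move=> k u v; rewrite scaler_sumr -big_split; apply: eq_bigr => j _ /=.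
  by rewrite (Cc_opL rP) bop_linear.
have bnd : exists N : C, forall u, `|\sum_j pi (s j) (r (b j) u)| <= N * `|u|.
  exists (\sum_j M j) => u; rewrite mulr_suml.
  apply: (le_trans (ler_norm_sum _ _ _)); apply: ler_sum => j _.
  apply: (le_trans (pi_contraction _ _)); have [M0 bM] := MP j.
  exact: (Cc_op_bound rP u (Cb j) M0 bM).
by exists (BoundedOp lin bnd).
Qed.

(** The difference of the two sums is a single vanishing sum over [I + J], with the sign absorbed in
    the coefficients. *)
Lemma sum_pi_eq (I J : finType) (s : I -> S) (b : I -> X -> C)
    (t : J -> S) (c : J -> X -> C) :
  (forall k, Cc (b k)) -> (forall j, Cc (c j)) ->
  (forall sigma, \sum_k mono (s k) (b k) sigma = \sum_j mono (t j) (c j) sigma) ->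
  forall u, \sum_k pi (s k) (r (b k) u) = \sum_j pi (t j) (r (c j) u).
Proof.
move=> Cb Cc_c E u; apply/eqP; rewrite -subr_eq0; apply/eqP.
pose st (k : I + J) := match k with inl k => s k | inr j => t j end.
pose bc (k : I + J) := match k with inl k => b k | inr j => fun x => - c j x end.
have Cbc k : Cc (bc k) by case: k => [k|j]; [exact: Cb|exact: CcN].
rewrite -[RHS](@sum_pi_eq0 _ st bc Cbc _ u).
  rewrite big_sumType /= -sumrN; congr (_ + _); apply: eq_bigr => j _.
  rewrite -[RHS]opprK; congr (- _).
  rewrite -scaleN1r -boundedOpZ -(Cc_opZ rP _ (Cbc (inr j))).
  by congr (pi _ (r _ u)); apply/funext => x; rewrite /= mulN1r opprK.
move=> sigma; rewrite big_sumType /= E -big_split big1 // => j _ /=.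
by rewrite /mono mulrN subrr.
Qed.

(** Quantifying over all expressions of f, with any finite index type, builds well-definedness into
    the specification; each law can then be checked on a convenient expression, such as one over a
    sum or product type. *)
Definition represented_by (f : Sigma tw -> C) (a : boundedOp K) :=
  forall (J : finType) (s : J -> S) (b : J -> X -> C), (forall j, Cc (b j)) ->
  (forall sigma, f sigma = \sum_j mono (s j) (b j) sigma) ->
  forall u, a u = \sum_j pi (s j) (r (b j) u).

Lemma represented_exists f : twisted_Cc tw f -> exists a, represented_by f a.
Proof.
move=> [n [s [b [Cb fE]]]]; have [a aE] := sum_pi_bounded s Cb.
exists a => J t c Cc_c fE' u; rewrite aE; apply: sum_pi_eq => // sigma.
by rewrite -fE' fE.
Qed.

Section Extension.
Variable rho : twisted_Cc tw -> boundedOp K.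
Hypothesis rhoE : forall f, represented_by (val f) (rho f).

Lemma represented_Delta s : rho (Delta_fun tw s) = pi s.
Proof.
apply: boundedOpP => u.
rewrite (@rhoE (Delta_fun tw s) unit (fun=> s) (fun=> ind (dom s))).
- by rewrite big_const card_unit /= addr0 pi_dom.
- by move=> _; exact: Cc_ind (dom_copen tw s).
- by move=> sigma; rewrite big_const card_unit /= addr0 -Delta_mono.
Qed.

Lemma twisted_repr (f : twisted_Cc tw) : exists n (s : 'I_n -> S) (b : 'I_n -> X -> C),
  (forall k, Cc (b k)) /\ forall sigma, val f sigma = \sum_k mono (s k) (b k) sigma.
Proof. by have [n [s [b [Cb fE]]]] := set_valP f; exists n, s, b; rewrite fE. Qed.

Lemma represented_Cc_rep : Cc_rep rho.
Proof.
split.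
- move=> f g h hfg u.
  have [n [s [b [Cb fE]]]] := twisted_repr f; have [m [t [c [Cc_c gE]]]] := twisted_repr g.
  pose st (k : 'I_n + 'I_m) := match k with inl k => s k | inr j => t j end.
  pose bc (k : 'I_n + 'I_m) := match k with inl k => b k | inr j => c j end.
  rewrite (@rhoE f _ _ _ Cb fE).
  rewrite (@rhoE g _ _ _ Cc_c gE).
  rewrite (@rhoE h _ st bc).
  + by rewrite big_sumType.
  + by case=> k; [exact: Cb|exact: Cc_c].
  + by move=> sigma; rewrite hfg fE gE big_sumType.
- move=> k f h hf u; have [n [s [b [Cb fE]]]] := twisted_repr f.
  rewrite (@rhoE f _ _ _ Cb fE).
  rewrite (@rhoE h _ s (fun j x => k * b j x)).
  + by rewrite scaler_sumr; apply: eq_bigr => j _; rewrite (Cc_opZ rP) // boundedOpZ.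
  + by move=> j; exact: CcZ.
  + by move=> sigma; rewrite hf fE mulr_sumr; apply: eq_bigr => j _; rewrite /mono mulrCA.
- move=> f g h hfg u.
  have [n [s [b [Cb fE]]]] := twisted_repr f; have [m [t [c [Cc_c gE]]]] := twisted_repr g.
  (* By [mono_conv] the product is expressed over pairs of indices; on the operator side the
     coefficient b_j crosses pi(t_j') by [r_pi_commute]. *)
  rewrite (@rhoE h _ (fun k : 'I_n * 'I_m => (s k.1 * t k.2)%g)
    (fun k x => pull tw (t k.2) (b k.1) x * c k.2 x)).
  + rewrite (@rhoE g _ _ _ Cc_c gE).
    rewrite (@rhoE f _ _ _ Cb fE).
    rewrite -(pair_bigA _ (fun j j' => pi (s j * t j')%g
      (r (fun x => pull tw (t j') (b j) x * c j' x) u))) /=.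
    apply: eq_bigr => j _; rewrite (Cc_op_vsum rP) boundedOp_sum; apply: eq_bigr => j' _.
    have Cp := Cc_pull tw (t j') (Cb j).1.
    by rewrite (twist_repM piP) (Cc_opM rP Cp (Cc_c j')) -r_pi_commute.
  + by move=> k; apply: CcM; [exact: Cc_pull (Cb k.1).1|exact: Cc_c].
  + move=> sigma; rewrite hfg (funext fE) (funext gE) germ_conv_sum; last by move=> j; exact: mono_germ_finite.
    rewrite pair_bigA; apply: eq_bigr => k _ /=.
    by rewrite mono_conv.
- move=> f h hf u v; have [n [s [b [Cb fE]]]] := twisted_repr f.
  rewrite (@rhoE h _ (fun j => (s j)^*)%g
    (fun j => pull tw (s j)^*%g (fun x => (b j x)^*))).
  + rewrite (@rhoE f _ _ _ Cb fE).
    rewrite linear_sumlz linear_sumr; apply: eq_bigr => j _.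
    rewrite -r_pi_commute; last exact: Cc_conj.
    exact: etrans (Cc_opJ rP (Cb j) _ _) (twist_repJ piP _ _ _).
  + by move=> j; apply: Cc_pull; exact: continuous_conj (Cb j).1.
  + move=> sigma; rewrite hf /germ_star fE /= rmorph_sum; apply: eq_bigr => j _.
    by rewrite -mono_star.
Qed.

End Extension.

End TwistRepresentation.

Theorem theoremB7 (R : realType) (X : booleanSpaceType) (G S : invSemigroupType)
    (D : dualSpace X G) (tw : twist R S D) (K : hilbertType R) :
  boolean G ->
  set_bij [set pit : twisted_Cc tw -> boundedOp K | Cc_rep pit]
          [set pi : S -> boundedOp K | twist_rep tw pi]
          (fun pit s => pit (Delta_fun tw s)).
Proof.
move=> _; split.
- by move=> rho; exact: Delta_fun_twist_rep.
- move=> rho rho' /set_mem rhoP /set_mem rhoP' E.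
  by apply: Cc_rep_inj => // s; exact: (congr1 (fun q => q s) E).
(* Surjectivity: the extension to C0(X) that comes with pi, restricted to [Cc], supplies the
   coefficients, and choice collects the operators of all f. *)
- move=> pi /= piP; have [q [qP qi] qE] := twist_rep_circle piP.
  have rP := star_rep_Cc_op (@Cc_C0 R X) qP.
  have rc h u : pi (tw_i tw h) u = total_rep q h u by rewrite qE -total_repE.
  have /choice[rho rhoE] : forall f : twisted_Cc tw,
      exists a : boundedOp K, represented_by pi (total_rep q) (val f) a.
    by move=> f; apply: represented_exists piP _ rP rc _ (set_valP f).
  have rhoP := represented_Cc_rep piP rP rc rhoE.
  exists rho; first exact: rhoP.
  by apply/funext => s; exact: represented_Delta.
Qed.
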